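(* Let $R$ be an indecomposable commutative unital ring, $\Gamma$ a (discrete) group with identity $\epsilon$, $A=\bigoplus_{\gamma\in\Gamma}A_\gamma$ a $\Gamma$-graded $R$-algebra, $C\subseteq A_\epsilon$ a commutative subalgebra, and suppose that $(A,C)$ is a graded algebraic quasi-Cartan pair. Let $\Sigma_\star$ be the groupoid of ultrafilters on the inverse semigroup $N_\star(C)$ of homogeneous normalisers, let $G_\star=\Sigma_\star/{\simeq}$ with quotient map $q:\Sigma_\star\to G_\star$, and let $a\mapsto\widehat a$ be the map from $A$ to the $R$-module $C(\Sigma_\star,R)$ defined in the context. Then $\varphi: a\mapsto \widehat a$ is a graded isomorphism of $A$ onto the twisted Steinberg algebra $A_R(G_\star;\Sigma_\star)$ that takes $C$ to $A_R(G_\star^{(0)};q^{-1}(G_\star^{(0)}))$.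
   Context: **Graded algebras.** $A=\bigoplus_{\gamma\in\Gamma}A_\gamma$ is a (not necessarily unital) $\Gamma$-graded $R$-algebra: each $A_\gamma$ is an $R$-submodule and $A_\gamma A_\lambda\subseteq A_{\gamma\lambda}$. Write $\deg(a)=\gamma$ if $a\in A_\gamma\setminus\{0\}$. A ring is indecomposable if its only idempotents are $0$ and $1$. A graded homomorphism $f:A\to B$ of $\Gamma$-graded algebras is an $R$-algebra homomorphism with $f(A_\gamma)\subseteq B_\gamma$ for all $\gamma$. **Normalisers.** For a commutative subalgebra $C$ of an $R$-algebra $B$, $I(C)$ denotes the set of idempotents of $C$. An element $n\in B$ is a normaliser of $C$ in $B$ if there is $m\in B$ with $mnm=m$, $nmn=n$ and $mCn\cup nCm\subseteq C$; $N_B(C)$ is the set of normalisers. $I(C)$ is a set of local units for $B$ if for every finite $F\subseteq B$ there is $e\in I(C)$ with $ea=a=ae$ for all $a\in F$; in that case $m$ is unique and is written $n^\dagger$. For graded $A$ and $C\subseteq A_\epsilon$, $N_\star(C)=\bigcup_{\gamma}(N_A(C)\cap A_\gamma)$ is the set of homogeneous normalisers. Condition (WT) for $C$: if $e\in I(C)\setminus\{0\}$, $t\in R$ and $te=0$, then $t=0$. **Pairs.** Let $C\subseteq B$ be a commutative subalgebra satisfying (WT). A conditional expectation $P:B\to C$ is an $R$-linear map with $P|_C=\mathrm{id}_C$ and $P(cbc')=cP(b)c'$ for $b\in B$, $c,c'\in C$. It is faithful if for every $b\in B\setminus\{0\}$ there is $n\in N_B(C)$ with $P(nb)\ne0$.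 It is implemented by idempotents if for every $n\in N_B(C)$ there is $e\in I(C)$ with $P(n)=ne=en$. $(B,C)$ is an algebraic quasi-Cartan pair (AQP) if $I(C)$ is a set of local units for $B$, $C=\mathrm{span}_R I(C)$, $B=\mathrm{span}_R N_B(C)$, and there is a faithful conditional expectation $P:B\to C$ implemented by idempotents. $(A,C)$ is a graded algebraic quasi-Cartan pair if $(A_\epsilon,C)$ is an AQP and $N_\star(C)$ spans $A$. **The groupoids.** $N_\star(C)$ is an inverse semigroup under multiplication with inverse $n\mapsto n^\dagger$ and idempotents $I(C)$; its natural partial order is $m\le n\iff m=nm^\dagger m$. For $U\subseteq N_\star(C)$, $U^{\uparrow}=\{m\in N_\star(C):\exists n\in U,\ n\le m\}$. A filter is a subset $U\subseteq N_\star(C)\setminus\{0\}$ with $U=U^\uparrow$ such that for all $m,n\in U$ there is $p\in U$ with $p\le m,n$. An ultrafilter is a maximal filter. $\Sigma_\star$ is the set of ultrafilters, a groupoid with $U^{-1}=\{n^\dagger:n\in U\}$; $(U,V)$ is composable iff $mn\neq0$ for all $m\in U,n\in V$, and then $UV=\{mn:m\in U,n\in V\}^\uparrow$. So $s(U)=U^{-1}U$, $r(U)=UU^{-1}$, and $\Sigma_\star^{(0)}=\{U:U\cap I(C)\ne\emptyset\}$. The sets $\mathcal V_n=\{U\in\Sigma_\star:n\in U\}$, $n\in N_\star(C)$, are a basis for its topology. For $t\in R^\times$, $tU=\{tm:m\in U\}\in\Sigma_\star$. Put $U\simeq W\iff U=tW$ for some $t\in R^\times$; $G_\star=\Sigma_\star/{\simeq}$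 has the quotient topology, quotient map $q$, and groupoid structure $q(U)^{-1}=q(U^{-1})$, $q(U)q(W)=q(UW)$ for $(U,W)\in \Sigma_\star^{(2)}$. Gradings: all elements of an ultrafilter $U$ have the same degree; $c_{\Sigma_\star}(U)=\deg(n)$ for any $n\in U$, and $c_{G_\star}(q(U))=c_{\Sigma_\star}(U)$. **Twisted Steinberg algebra.** $C(\Sigma_\star,R)$ is the $R$-module of locally constant functions $\Sigma_\star\to R$. $\mathrm{supp}(f)=\{U:f(U)\neq0\}$ and $\mathrm{supp}_G(f)=q(\mathrm{supp}(f))$. $A_R(G_\star;\Sigma_\star)$ is the set of $f\in C(\Sigma_\star,R)$ with $f(tU)=t^{-1}f(U)$ for all $t\in R^\times$, $U\in\Sigma_\star$, and $\mathrm{supp}_G(f)$ compact, with pointwise linear operations and product $(f*g)(\sigma)=\sum_{\alpha\in\mathrm{supp}_G(f),\,r(\alpha)=r(\sigma)}f(S(\alpha))g(S(\alpha)^{-1}\sigma)$ for any (not necessarily continuous) section $S:\mathrm{supp}_G(f)\to\mathrm{supp}(f)$ of $q$ (the result does not depend on $S$). Its grading has components $\{f:\mathrm{supp}_G(f)\subseteq c_{G_\star}^{-1}(\gamma)\}$. $A_R(G_\star^{(0)};q^{-1}(G_\star^{(0)}))$ is viewed (via extension by zero) as the subalgebra of those $f$ with $\mathrm{supp}_G(f)\subseteq G_\star^{(0)}$. **The map $a\mapsto\widehat a$.** Let $P:A_\epsilon\to C$ be the faithful conditional expectation implemented by idempotents. Let $A_R(\Sigma_\star^{(0)})$ be the algebra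 of compactly supported locally constant functions $\Sigma_\star^{(0)}\to R$ with pointwise operations, and $\phi:C\to A_R(\Sigma_\star^{(0)})$ the $R$-algebra isomorphism with $\phi(e)=1_{\mathcal V_e}$ for all $e\in I(C)$. For $a_\alpha\in A_\alpha$ define $\widehat{a_\alpha}(U)=\phi(P(n^\dagger a_\alpha))(s(U))$ if $c_{\Sigma_\star}(U)=\alpha$, where $n\in U$ is arbitrary (the value does not depend on $n$), and $\widehat{a_\alpha}(U)=0$ otherwise. For $a=\sum_\alpha a_\alpha$ with $a_\alpha\in A_\alpha$, put $\widehat a=\sum_\alpha\widehat{a_\alpha}$. *)

(* Defs.v *)
From HB Require Import structures.
From mathcomp Require Import all_boot all_algebra generic_quotient.
From mathcomp Require Import all_classical.
From mathcomp Require Import topology.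

Set Implicit Arguments.
Unset Strict Implicit.
Unset Printing Implicit Defensive.

Import GRing.Theory.

Local Open Scope classical_set_scope.
Local Open Scope ring_scope.
Local Open Scope quotient_scope.

(* Associative algebras with no unit element required. *)
HB.mixin Record Lmodule_isNUAlgebra (R : comPzRingType) A of GRing.Lmodule R A
    := {
  amul : A -> A -> A;
  amulA : associative amul;
  amulDl : left_distributive amul +%R;
  amulDr : right_distributive amul +%R;
  ascaleAl : forall (k : R) (a b : A), k *: amul a b = amul (k *: a) b;
  ascaleAr : forall (k : R) (a b : A), k *: amul a b = amul a (k *: b)
}.

#[short(type="nuAlgType")]
HB.structure Definition NUAlgebra (R : comPzRingType) :=
  {A of Lmodule_isNUAlgebra R A & GRing.Lmodule R A}.

Local Notation "a ** b" := (amul a b) (at level 40, left associativity).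

Definition indecomposable (R : comPzRingType) : Prop :=
  forall x : R, x * x = x -> x = 0 \/ x = 1.

Section Subalgebras.
Variables (R : comPzRingType) (A : nuAlgType R).
Implicit Types (B C : set A) (P : A -> A).

Definition is_submodule B : Prop :=
  [/\ B 0, forall a b, B a -> B b -> B (a + b)
    & forall (r : R) a, B a -> B (r *: a)].

Definition is_subalgebra B : Prop :=
  is_submodule B /\ forall a b, B a -> B b -> B (a ** b).

Definition is_comm_subalgebra C : Prop :=
  is_subalgebra C /\ forall a b, C a -> C b -> a ** b = b ** a.

Definition Rspan (X : set A) : set A :=
  [set a | exists (n : nat) (r : 'I_n -> R) (x : 'I_n -> A),
     (forall i, X (x i)) /\ a = \sum_(i < n) r i *: x i].

Definition idempotents C : set A := [set e | C e /\ e ** e = e].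

Definition is_dagger C (n m : A) : Prop :=
  [/\ m ** n ** m = m, n ** m ** n = n
    & forall c, C c -> C (m ** c ** n) /\ C (n ** c ** m)].

Definition normalisers B C : set A :=
  [set n | B n /\ exists2 m, B m & is_dagger C n m].

Definition local_units B C : Prop :=
  forall F : set A, finite_set F -> F `<=` B ->
    exists2 e, idempotents C e & forall a, F a -> e ** a = a /\ a ** e = a.

Definition condition_WT C : Prop :=
  forall (e : A) (t : R), idempotents C e -> e <> 0 -> t *: e = 0 -> t = 0.

(* Maps B -> C are represented by maps A -> A whose values off B are
   irrelevant. *)
Definition conditional_expectation B C P : Prop :=
  [/\ forall (r : R) b b', B b -> B b' -> P (r *: b + b') = r *: P b + P b',
      forall b, B b -> C (P b),
      forall c, C c -> P c = c
    & forall c b c', C c -> B b -> C c' -> P (c ** b ** c') = c ** P b ** c'].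

Definition faithful_expectation B C P : Prop :=
  forall b, B b -> b <> 0 -> exists2 n, normalisers B C n & P (n ** b) <> 0.

Definition implemented_by_idempotents B C P : Prop :=
  forall n, normalisers B C n ->
    exists2 e, idempotents C e & P n = n ** e /\ P n = e ** n.

Definition AQP_expectation B C P : Prop :=
  [/\ conditional_expectation B C P, faithful_expectation B C P
    & implemented_by_idempotents B C P].

Definition AQP B C : Prop :=
  [/\ is_subalgebra B, is_comm_subalgebra C, C `<=` B & condition_WT C] /\
  [/\ local_units B C, C = Rspan (idempotents C), B = Rspan (normalisers B C)
    & exists P, AQP_expectation B C P].

End Subalgebras.

Definition nu_pointed (R : comPzRingType) (A : nuAlgType R) : pointedType :=
  HB.pack (A : choiceType) (isPointed.Build A 0).

Section Graded.
Variables (R : comPzRingType) (Gamma : groupType) (A : nuAlgType R).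
Variable Ag : Gamma -> set A.

Definition homogeneous_decomposition (a : A) : set (Gamma -> A) :=
  [set d | [/\ finite_set [set gamma | d gamma != 0],
               forall gamma, Ag gamma (d gamma)
             & a = \sum_(gamma \in [set: Gamma]) d gamma]].

(* Existence and uniqueness of homogeneous decompositions say that A is the
   internal direct sum of the Ag gamma. *)
Definition graded_algebra : Prop :=
  [/\ forall gamma, is_submodule (Ag gamma),
      forall a, exists! d, homogeneous_decomposition a d
    & forall gamma lambda a b, Ag gamma a -> Ag lambda b ->
        Ag (gamma * lambda)%g (a ** b)].

Definition component (gamma : Gamma) (a : A) : A :=
  xget (fun=> 0) (homogeneous_decomposition a) gamma.

(* deg a is meaningful for nonzero homogeneous a only. *)
Definition deg (a : A) : Gamma := xget 1%g [set gamma | Ag gamma a].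

Variable C : set A.

Definition Nstar : set A :=
  \bigcup_(gamma in [set: Gamma]) (normalisers [set: A] C `&` Ag gamma).

Definition graded_AQP : Prop := AQP (Ag 1%g) C /\ Rspan Nstar = [set: A].

Definition dagger (n : A) : A := xget 0 [set m | is_dagger C n m].

Definition nle (m n : A) : Prop := m = n ** dagger m ** m.

Definition upset (U : set A) : set A :=
  [set m | Nstar m /\ exists2 n, U n & nle n m].

(* Filters are nonempty, so that every ultrafilter has a degree and the sets
   Vset n cover the space of ultrafilters. *)
Definition is_nfilter (U : set A) : Prop :=
  [/\ U !=set0, U `<=` Nstar `\ 0, U = upset U
    & forall m n, U m -> U n -> exists p, [/\ U p, nle p m & nle p n]].

Definition is_nultrafilter (U : set A) : Prop :=
  is_nfilter U /\ forall V, is_nfilter V -> U `<=` V -> V = U.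

Record Sigma :=
  MkSigma { ucarrier :> set A; _ : `[< is_nultrafilter ucarrier >] }.

HB.instance Definition _ := [isSub for ucarrier].
HB.instance Definition _ := [Choice of Sigma by <:].

Lemma SigmaP (U : Sigma) : is_nultrafilter U.
Proof. by case: U => U /= /asboolP. Qed.

Definition Vset (n : A) : set Sigma := [set U | (U : set A) n].

Lemma Vset_cover :
  \bigcup_(n in (Nstar : set (nu_pointed A))) Vset n = [set: Sigma].
Proof.
apply/seteqP; split=> // U _; have [[[n Un] sU _ _] _] := SigmaP U.
by exists n => //; case: (sU _ Un).
Qed.

Lemma Vset_join (i j : nu_pointed A) (U : Sigma) :
  Nstar i -> Nstar j -> Vset i U -> Vset j U ->
  exists k : nu_pointed A,
    [/\ Nstar k, Vset k U & Vset k `<=` Vset i `&` Vset j].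
Proof.
move=> Ni Nj Ui Uj; have [[_ sU _ dirU] _] := SigmaP U.
have [p [Up pi pj]] := dirU _ _ Ui Uj.
exists p; split=> //; first by case: (sU _ Up).
move=> W Wp; have [[_ _ upW _] _] := SigmaP W.
by split; rewrite /Vset /= upW; split=> //; exists p.
Qed.

HB.instance Definition _ := isBaseTopological.Build Sigma Vset_cover Vset_join.

(* insubd U X is the ultrafilter X; the sets X it is applied to below are known
   to be ultrafilters (for mulS, when the pair is composable), so that the
   default U plays no role. *)
Definition inverseS (U : Sigma) : Sigma := insubd U (dagger @` U).

Definition mulS (U V : Sigma) : Sigma :=
  insubd U (upset [set m ** n | m in U & n in V]).

Definition scaleS (t : R) (U : Sigma) : Sigma :=
  insubd U [set t *: m | m in U].

Definition srcS (U : Sigma) : Sigma := mulS (inverseS U) U.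
Definition rngS (U : Sigma) : Sigma := mulS U (inverseS U).

Definition Sigma0 : set Sigma :=
  [set U | (U : set A) `&` idempotents C !=set0].

(* t ranges over the units of R; s is the inverse of t. *)
Definition simeq (U W : Sigma) : bool :=
  `[< exists t s : R, t * s = 1 /\ (U : set A) = [set t *: m | m in W] >].

Lemma simeq_refl : reflexive simeq.
Proof.
move=> U; apply/asboolP; exists 1, 1; rewrite mulr1; split=> //.
apply/seteqP; split=> m; first by exists m; rewrite ?scale1r.
by move=> [n Un <-]; rewrite scale1r.
Qed.

Lemma simeq_sym : symmetric simeq.
Proof.
suff h U W : simeq U W -> simeq W U by move=> U W; apply/idP/idP; exact: h.
move=> /asboolP[t [s [ts UW]]]; apply/asboolP; exists s, t; rewrite mulrC UW.
split=> //; apply/seteqP; split=> m.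
  by move=> Wm; exists (t *: m); [exists m|rewrite scalerA mulrC ts scale1r].
by move=> [_ [n Wn <-] <-]; rewrite scalerA mulrC ts scale1r.
Qed.

Lemma simeq_trans : transitive simeq.
Proof.
move=> V U W /asboolP[t [s [ts UV]]] /asboolP[t' [s' [ts' VW]]].
apply/asboolP; exists (t * t'), (s * s'); split.
  by rewrite mulrACA ts ts' mulr1.
rewrite UV VW; apply/seteqP; split=> m.
  by move=> [_ [n Wn <-] <-]; exists n; rewrite ?scalerA.
by move=> [n Wn <-]; exists (t' *: n); [exists n|rewrite scalerA].
Qed.

Canonical simeq_equiv := EquivRel simeq simeq_refl simeq_sym simeq_trans.

Definition Gstar := quotient_topology {eq_quot simeq_equiv}.
HB.instance Definition _ := Topological.on Gstar.
HB.instance Definition _ := Quotient.on Gstar.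

Definition qG (U : Sigma) : Gstar := \pi_Gstar U.

(* r(qG(U)) = qG(r(U)), as prescribed by the groupoid structure of Gstar. *)
Definition rngG (alpha : Gstar) : Gstar := qG (rngS (repr alpha)).

Definition Gstar0 : set Gstar := qG @` Sigma0.

Definition cSigma (U : Sigma) : Gamma := deg (xget 0 (U : set A)).
Definition cG (alpha : Gstar) : Gamma := cSigma (repr alpha).

Implicit Types f g : Sigma -> R.

Definition supp f : set Sigma := [set U | f U != 0].
Definition suppG f : set Gstar := qG @` supp f.

Definition locally_constant f : Prop := forall U, \forall V \near U, f V = f U.

Definition twisted_steinberg : set (Sigma -> R) :=
  [set f | [/\ locally_constant f,
               forall (t s : R) U, t * s = 1 -> f (scaleS t U) = s * f U
             & compact (suppG f)]].

Definition twisted_steinberg_component (gamma : Gamma) : set (Sigma -> R) :=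
  [set f | twisted_steinberg f /\ suppG f `<=` cG @^-1` [set gamma]].

Definition twisted_steinberg0 : set (Sigma -> R) :=
  [set f | twisted_steinberg f /\ suppG f `<=` Gstar0].

Definition section_of f (S : Gstar -> Sigma) : Prop :=
  forall alpha, suppG f alpha -> supp f (S alpha) /\ qG (S alpha) = alpha.

(* Sigma0 and the unit space of Gstar are identified along qG in the condition
   r(alpha) = r(sigma). For f in twisted_steinberg the index set is finite. *)
Definition convolution (S : Gstar -> Sigma) f g : Sigma -> R := fun sigma =>
  \sum_(alpha \in [set alpha | suppG f alpha /\ rngG alpha = qG (rngS sigma)])
    f (S alpha) * g (mulS (inverseS (S alpha)) sigma).

(* The algebra of compactly supported locally constant functions on Sigma0,
   such a function being represented by its extension by zero to Sigma. *)
Definition steinberg_Sigma0 : set (Sigma -> R) :=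
  [set f | [/\ forall U, ~ Sigma0 U -> f U = 0,
               forall U, Sigma0 U -> \forall V \near within Sigma0 (nbhs U),
                 f V = f U
             & compact (supp f)]].

Definition is_phi (phi : A -> Sigma -> R) : Prop :=
  [/\ forall (r : R) c c', C c -> C c' ->
        phi (r *: c + c') = fun U => r * phi c U + phi c' U,
      forall c c', C c -> C c' -> phi (c ** c') = fun U => phi c U * phi c' U,
      set_bij C steinberg_Sigma0 phi
    & forall e, idempotents C e -> phi e = fun U => (`[< Vset e U >])%:R].

Definition phi : A -> Sigma -> R := xget (fun _ _ => 0) [set h | is_phi h].

Variable P : A -> A.

Definition hat_homogeneous (alpha : Gamma) (a : A) : Sigma -> R := fun U =>
  if cSigma U == alpha then
    let n := xget 0 (U : set A) in phi (P (dagger n ** a)) (srcS U)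
  else 0.

Definition hat (a : A) : Sigma -> R := fun U =>
  \sum_(alpha \in [set: Gamma]) hat_homogeneous alpha (component alpha a) U.

Definition graded_isomorphism (h : A -> Sigma -> R) : Prop :=
  [/\ forall (r : R) a b, h (r *: a + b) = fun U => r * h a U + h b U,
      forall a b S, section_of (h a) S ->
        h (a ** b) = convolution S (h a) (h b),
      set_bij [set: A] twisted_steinberg h
    & forall gamma, h @` Ag gamma `<=` twisted_steinberg_component gamma].

End Graded.

Arguments Sigma {R Gamma A} Ag C.
Arguments Gstar {R Gamma A} Ag C.
Arguments Sigma0 {R Gamma A} Ag C.
Arguments Gstar0 {R Gamma A} Ag C.
Arguments Vset {R Gamma A} Ag C n.
Arguments twisted_steinberg {R Gamma A} Ag C.
Arguments twisted_steinberg_component {R Gamma A} Ag C gamma.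
Arguments twisted_steinberg0 {R Gamma A} Ag C.
Arguments steinberg_Sigma0 {R Gamma A} Ag C.
Arguments is_phi {R Gamma A} Ag C phi.
Arguments phi {R Gamma A} Ag C.
Arguments hat_homogeneous {R Gamma A} Ag C P alpha a.
Arguments hat {R Gamma A} Ag C P a.
Arguments graded_isomorphism {R Gamma A} Ag C h.

(* Main.v *)
Require Import Defs.
From HB Require Import structures.
From mathcomp Require Import all_boot all_algebra.
From mathcomp Require Import all_classical.
From mathcomp Require Import topology.

(** Write [E a] for the conditional expectation of the unit component of [a]; it
is a conditional expectation of the whole algebra onto [C]. The proof rests on
one construction: at an ultrafilter [U], every element [a] has a scalar value
[r], determined by the equation [E (n† ** a) = r *: (n† ** n)] for all small
enough [n] in [U]. It exists because [C] is spanned by idempotents and an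
ultrafilter decides each idempotent ([uf_mulI], [uf_scalar]), and it is unique
by condition (WT). The hat map is this value map ([hat_value]). Linearity, local
constancy and the twisted equivariance are then immediate.

The main point is [value_N_cases]: a normaliser [n] has a nonzero value at [U]
only if a unit multiple of [n] belongs to [U]. So the value function of [n] is
the elementary twisted function carried by the unit multiples of the basic open
set of [n]. Four facts follow from it.
- Supports are compact, because basic open sets are ([compact_Vset]): the
  restrictions of [n] to idempotents form a Boolean algebra, and [Vset n] is its
  Stone space.
- The value map is onto. By compactness, a twisted function is on each of
  finitely many basic sets a multiple of an elementary function, and the sets
  can be made disjoint, since the part of [n] where [m] has value zero is again
  a normaliser ([ndiff], [span_cover]). If the function lives over the unit
  space, then the normalisers can be taken idempotent.
- The value map is injective. By faithfulness of the expectation, some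
  [E (n† ** a)] is nonzero if [a] is; it is then a nonzero scalar on some
  idempotent below the source of [n], and Zorn's lemma gives an ultrafilter
  there ([value_separates], [value_injective]).
- The value map is multiplicative. By linearity the left factor may be taken to
  be a normaliser [n]; then the convolution at [U] has at most one term, that of
  the arrow containing [n] with the range of [U], and left translation by [n†]
  turns values of [n ** b] into values of [b] ([convolution_normaliser]).

The isomorphism [phi] in the definition of the hat map is specified by its
properties only. The same arguments over the unit space prove that it exists
([is_phi0]) and that it is the restriction of the value map ([phi_value]). *)

Set Implicit Arguments.
Unset Strict Implicit.
Unset Printing Implicit Defensive.

Import GRing.Theory.

Local Open Scope classical_set_scope.
Local Open Scope ring_scope.

Local Notation "a ** b" := (amul a b) (at level 40, left associativity).

(** * Algebras without unit and linear spans *)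

Section NonUnitalAlgebra.
Variables (R : comPzRingType) (A : nuAlgType R).
Implicit Types (a b c : A) (X : set A).

Lemma amul0r a : 0 ** a = 0.
Proof. by apply: (addrI (0 ** a)); rewrite -amulDl !addr0. Qed.

Lemma amulr0 a : a ** 0 = 0.
Proof. by apply: (addrI (a ** 0)); rewrite -amulDr !addr0. Qed.

Lemma amulNr a b : - a ** b = - (a ** b).
Proof. by apply: (addrI (a ** b)); rewrite -amulDl !subrr amul0r. Qed.

Lemma amulrN a b : a ** - b = - (a ** b).
Proof. by apply: (addrI (a ** b)); rewrite -amulDr !subrr amulr0. Qed.

Lemma amulBl a b c : (a - b) ** c = a ** c - b ** c.
Proof. by rewrite amulDl amulNr. Qed.

Lemma amulBr a b c : c ** (a - b) = c ** a - c ** b.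
Proof. by rewrite amulDr amulrN. Qed.

Lemma amulZl (r : R) a b : (r *: a) ** b = r *: (a ** b).
Proof. by rewrite ascaleAl. Qed.

Lemma amulZr (r : R) a b : a ** (r *: b) = r *: (a ** b).
Proof. by rewrite ascaleAr. Qed.

Lemma Rspan_ind X (Q : A -> Prop) : Q 0 ->
    (forall (r : R) x y, X x -> Q y -> Q (r *: x + y)) ->
  forall a, Rspan X a -> Q a.
Proof.
move=> Q0 QD a [n [r [x [Xx ->]]]]; elim: n r x Xx => [|n ih] r x Xx.
  by rewrite big_ord0.
by rewrite big_ord_recl; apply: QD => //; apply: ih => i; apply: Xx.
Qed.

Lemma Rspan0 X : Rspan X 0.
Proof. by exists 0%N, (fun=> 0), (fun=> 0); split=> [[]//|]; rewrite big_ord0. Qed.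

Lemma RspanD X (r : R) x a : X x -> Rspan X a -> Rspan X (r *: x + a).
Proof.
move=> Xx [n [s [y [Xy ->]]]].
exists n.+1, (fun i => oapp s r (unlift ord0 i)),
  (fun i => oapp y x (unlift ord0 i)); split.
  by move=> i; case: (unlift ord0 i) => [j|] /=.
rewrite big_ord_recl unlift_none /=; congr (_ + _).
by apply: eq_bigr => i _; rewrite liftK.
Qed.

End NonUnitalAlgebra.

(** * Finite subcovers *)

(** Compactness is used in its near-covering form, along the filter of finite
sets of indices: each point is covered as soon as one index is present. *)
Lemma compact_finite_cover (T : topologicalType) (K : set T) (I : choiceType)
    (D : set I) (f : I -> set T) : compact K ->
    (forall i, D i -> open (f i)) -> K `<=` \bigcup_(i in D) f i ->
  exists2 s : seq I, (forall i, i \in s -> D i) &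
    forall x, K x -> exists2 i, i \in s & f i x.
Proof.
move=> cK fo fK.
pose F := filter_from [set s : seq I | forall i, i \in s -> D i]
  (fun s => [set t : seq I | {subset s <= t}]).
have FF : Filter F.
  apply: filter_from_filter; first by exists [::].
  move=> s t sD tD; exists (s ++ t) => [i|u stu].
    by rewrite mem_cat => /orP[/sD|/tD].
  by split=> i it; apply: stu; rewrite mem_cat it ?orbT.
have /compact_near_coveringP := cK.
move=> /(_ _ F (fun s x => exists i, [/\ i \in s, D i & f i x])).
case=> [x /fK[i Di fxi]|s sD sK].
- exists (f i, [set t | {subset [:: i] <= t}]) => /=.
    split; first by apply: open_nbhs_nbhs; split=> //; exact: fo.
    by exists [:: i] => // j; rewrite inE => /eqP->.
  by move=> [y t] /= [fy it]; exists i; split=> //; apply: it; exact: mem_head.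
exists [seq i <- s | `[< D i >]] => [i|x].
  by rewrite mem_filter => /andP[/asboolP].
move=> /(sK s (fun i => id)) [i [si Di fxi]]; exists i => //.
by rewrite mem_filter si andbT; apply/asboolP.
Qed.

Section GradedQuasiCartanPair.
Variables (R : comPzRingType) (Gamma : groupType) (A : nuAlgType R).
Variables (Ag : Gamma -> set A) (C : set A) (P : A -> A).
Hypotheses (gradA : graded_algebra Ag) (commC : is_comm_subalgebra C)
  (subC : C `<=` Ag 1%g) (pairA : graded_AQP Ag C)
  (expP : AQP_expectation (Ag 1%g) C P).

Local Notation I := (idempotents C).
Local Notation N := (Nstar Ag C).
Local Notation comp := (component Ag).
Local Notation "n †" := (dagger C n) (at level 2, format "n †").
Implicit Types (a b c e f k m n p x y : A) (r s t : R).

(** * Homogeneous components *)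

Lemma hom0 gamma : Ag gamma 0.
Proof. by have [+ _ _] := gradA => /(_ gamma)[]. Qed.

Lemma homD gamma a b : Ag gamma a -> Ag gamma b -> Ag gamma (a + b).
Proof. by have [+ _ _] := gradA => /(_ gamma)[_ + _]; apply. Qed.

Lemma homZ gamma r a : Ag gamma a -> Ag gamma (r *: a).
Proof. by have [+ _ _] := gradA => /(_ gamma)[_ _]; apply. Qed.

Lemma homM gamma lambda a b :
  Ag gamma a -> Ag lambda b -> Ag (gamma * lambda)%g (a ** b).
Proof. by have [_ _] := gradA; apply. Qed.

Lemma decomposition_component a :
  homogeneous_decomposition Ag a (fun gamma => comp gamma a).
Proof.
have [_ /(_ a)[d [da _]] _] := gradA.
by rewrite /component; case: xgetP => [y -> //|/(_ d)].
Qed.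

Lemma component_unique a d gamma :
  homogeneous_decomposition Ag a d -> comp gamma a = d gamma.
Proof.
have [_ /(_ a)[d' [_ du]] _] := gradA => da.
by rewrite -(du _ da) (du _ (decomposition_component a)).
Qed.

Lemma component_hom gamma a : Ag gamma (comp gamma a).
Proof. by have [_ + _] := decomposition_component a; apply. Qed.

Lemma component_linear gamma r a b :
  comp gamma (r *: a + b) = r *: comp gamma a + comp gamma b.
Proof.
apply: (component_unique (d := fun gamma => r *: comp gamma a + comp gamma b)).
have [fa ha ea] := decomposition_component a.
have [fb hb eb] := decomposition_component b.
set D := [set g | comp g a != 0] `|` [set g | comp g b != 0].
have fD : finite_set D by rewrite finite_setU.
split=> [|g|].
- apply: sub_finite_set fD => g /=; apply: contraPP => /not_orP[/= /negP].
  by rewrite negbK => /eqP -> /negP; rewrite negbK => /eqP ->;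
    rewrite scaler0 addr0 eqxx.
- by apply: homD => //; apply: homZ.
have sum (h : Gamma -> A) : (forall g, ~ D g -> h g = 0) ->
    \sum_(g \in [set: Gamma]) h g = \sum_(g \in D) h g.
  by move=> h0; apply/esym/fsbig_widen => // g [_ /h0].
have E g : ~ D g -> comp g a = 0 /\ comp g b = 0.
  by move=> /not_orP[/negP + /negP]; rewrite !negbK => /eqP ? /eqP.
rewrite {1}ea {1}eb !sum; last 3 first.
- by move=> g /E[-> ->]; rewrite scaler0 addr0.
- by move=> g /E[].
- by move=> g /E[].
by rewrite fsbig_split// !fsbig_finite// scaler_sumr.
Qed.

Lemma component0 gamma : comp gamma 0 = 0.
Proof.
have := component_linear gamma 1 0 0.
by rewrite !scale1r addr0 => /(congr1 (fun x => x - comp gamma 0));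
  rewrite subrr addrK.
Qed.

Lemma component_of_hom gamma delta a :
  Ag gamma a -> comp delta a = if delta == gamma then a else 0.
Proof.
move=> ha.
apply: (component_unique (d := fun delta => if delta == gamma then a else 0)).
split=> [|g|].
- apply: (sub_finite_set _ (finite_set1 gamma)) => g /=.
  by case: (g =P gamma) => //= _; rewrite eqxx.
- by case: eqP => [->//|_]; exact: hom0.
rewrite -(@fsbig_widen _ _ _ _ [set gamma])//.
  by rewrite fsbig_set1 eqxx.
by move=> g [_ /=]; case: eqP.
Qed.

Lemma hom_unique gamma delta a :
  Ag gamma a -> Ag delta a -> a <> 0 -> gamma = delta.
Proof.
move=> ha hb a0; have := component_of_hom gamma hb.
by rewrite (component_of_hom gamma ha) eqxx; case: eqP.
Qed.

Lemma deg_hom gamma a : Ag gamma a -> a <> 0 -> deg Ag a = gamma.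
Proof.
move=> ha a0; rewrite /deg; case: xgetP => [d _ hd|/(_ gamma)//].
exact: hom_unique hd ha a0.
Qed.

Lemma Nstar_span_ind (Q : A -> Prop) : Q 0 ->
  (forall r n a, N n -> Q a -> Q (r *: n + a)) -> forall a, Q a.
Proof.
move=> Q0 QD a; apply: (Rspan_ind Q0 QD (a := a)).
by have [_ ->] := pairA.
Qed.

Lemma Nstar_hom n : N n -> exists gamma, Ag gamma n.
Proof. by move=> [g _ [_ ?]]; exists g. Qed.

(** Both sides are linear in [a], and for a homogeneous normaliser [a] they are
both [n ** a] or both zero. *)
Lemma component_mull gamma delta n a :
  Ag gamma n -> comp (gamma * delta)%g (n ** a) = n ** comp delta a.
Proof.
move=> hn; elim/Nstar_span_ind: a => [|r m a Nm ih].
  by rewrite amulr0 !component0 amulr0.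
rewrite amulDr amulZr !component_linear amulDr amulZr ih; congr (_ *: _ + _).
have [l hm] := Nstar_hom Nm.
rewrite (component_of_hom _ hm) (component_of_hom _ (homM hn hm)).
by rewrite (inj_eq (mulgI _)); case: eqP => //; rewrite amulr0.
Qed.

Lemma component_mulr gamma delta n a :
  Ag gamma n -> comp (delta * gamma)%g (a ** n) = comp delta a ** n.
Proof.
move=> hn; elim/Nstar_span_ind: a => [|r m a Nm ih].
  by rewrite amul0r !component0 amul0r.
rewrite amulDl amulZl !component_linear amulDl amulZl ih; congr (_ *: _ + _).
have [l hm] := Nstar_hom Nm.
rewrite (component_of_hom _ hm) (component_of_hom _ (homM hm hn)).
by rewrite (inj_eq (mulIg _)); case: eqP => //; rewrite amul0r.
Qed.

(** * The inverse semigroup of homogeneous normalisers *)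

Lemma C0 : C 0. Proof. by have [[[]]] := commC. Qed.

Lemma CD a b : C a -> C b -> C (a + b).
Proof. by have [[[_ + _]]] := commC => + _ _; apply. Qed.

Lemma CZ r a : C a -> C (r *: a).
Proof. by have [[[_ _ +]]] := commC => + _ _; apply. Qed.

Lemma CM a b : C a -> C b -> C (a ** b).
Proof. by have [[_ +]] := commC => + _; apply. Qed.

Lemma CC a b : C a -> C b -> a ** b = b ** a.
Proof. by have [_] := commC; apply. Qed.

Lemma IC e : I e -> C e. Proof. by case. Qed.

Lemma Iidem e : I e -> e ** e = e. Proof. by case. Qed.

Lemma IM e f : I e -> I f -> I (e ** f).
Proof.
move=> [Ce ee] [Cf ff]; split; first exact: CM.
by rewrite amulA -(amulA e) (CC Cf Ce) amulA ee -amulA ff.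
Qed.

Lemma I0 : I 0. Proof. by split; [exact: C0|rewrite amul0r]. Qed.

Lemma CN a : C a -> C (- a).
Proof. by move=> Ca; rewrite -scaleN1r; apply: CZ. Qed.

Lemma IB e f : I e -> I f -> I (e - e ** f).
Proof.
move=> Ie If; split.
  by apply: CD; [exact: IC|apply/CN/IC/IM].
have ef := Iidem (IM Ie If); have ee := Iidem Ie.
rewrite amulBl !amulBr ef ee amulA ee.
by rewrite -[e ** f ** e]amulA (CC (IC If) (IC Ie)) amulA ee subrr subr0.
Qed.

Lemma IU e f : I e -> I f -> I (e + (f - f ** e)).
Proof.
move=> Ie If; have [g gE [Cg gg]] : exists2 g, f - f ** e = g & I g.
  by exists (f - f ** e) => //; exact: IB.
have ge : g ** e = 0 by rewrite -gE amulBl -amulA Iidem// subrr.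
rewrite gE; split; first exact: CD (IC Ie) Cg.
by rewrite amulDl !amulDr gg ge (CC (IC Ie) Cg) ge Iidem// addr0 add0r.
Qed.

Lemma C_span_ind (Q : A -> Prop) : Q 0 ->
  (forall r e a, I e -> Q a -> Q (r *: e + a)) -> forall c, C c -> Q c.
Proof.
move=> Q0 QD c Cc; apply: (Rspan_ind Q0 QD).
by have [[_ [_ <- _ _]] _] := pairA.
Qed.

Lemma local_units1 (F : set A) : finite_set F -> F `<=` Ag 1%g ->
  exists2 e, I e & forall a, F a -> e ** a = a /\ a ** e = a.
Proof. by have [[_ [+ _ _ _]] _] := pairA; apply. Qed.

Lemma WT e t : I e -> e <> 0 -> t *: e = 0 -> t = 0.
Proof. by have [[[_ _ _ +] _] _] := pairA; apply. Qed.

(** The degree zero parts [nm'] and [m'n], where [m'] is the component of [m]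
of degree opposite to [n], already act as units on [n]; so local units of the
degree zero subalgebra are local units for all homogeneous normalisers. *)
Lemma local_unit_dagger gamma n m : Ag gamma n -> is_dagger C n m ->
  exists2 e, I e & e ** n = n /\ n ** e = n.
Proof.
move=> hn [_ nmn _]; pose m' := comp gamma^-1%g m.
have nm'n : n ** m' ** n = n.
  have : comp (1 * gamma)%g (n ** m ** n) = n.
    by rewrite mul1g nmn (component_of_hom _ hn) eqxx.
  by rewrite (component_mulr _ _ hn) -(mulgV gamma) (component_mull _ _ hn).
have hm' := component_hom gamma^-1%g m.
have [||e Ie he] := @local_units1 [set n ** m'; m' ** n].
- by rewrite finite_setU; split; exact: finite_set1.
- move=> _ [|] ->.
    by have := homM hn hm'; rewrite mulgV.
  by have := homM hm' hn; rewrite mulVg.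
exists e => //; split.
  have [+ _] := he (n ** m') (or_introl erefl).
  by move=> /(congr1 (fun x => x ** n)); rewrite -!amulA !(amulA n) nm'n.
have [_ +] := he (m' ** n) (or_intror erefl).
by move=> /(congr1 (amul n)); rewrite !amulA nm'n.
Qed.

Lemma idempotent_dagger gamma n m : Ag gamma n -> is_dagger C n m ->
  I (m ** n) /\ I (n ** m).
Proof.
move=> hn dnm; have [mnm nmn mnC] := dnm.
have [e Ie [en ne]] := local_unit_dagger hn dnm.
have [Cmn Cnm] := mnC _ (IC Ie).
split; split.
- by move: Cmn; rewrite -amulA en.
- by rewrite amulA mnm.
- by move: Cnm; rewrite ne.
- by rewrite amulA nmn.
Qed.

(** The usual uniqueness of inverses when idempotents commute: [m ** n] and
[n ** m] are determined by [n]. *)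
Lemma dagger_unique_hom gamma n m m' :
  Ag gamma n -> is_dagger C n m -> is_dagger C n m' -> m = m'.
Proof.
move=> hn dm dm'; have [Imn Inm] := idempotent_dagger hn dm.
have [Im'n Inm'] := idempotent_dagger hn dm'.
have [mnm nmn _] := dm; have [m'nm' nm'n _] := dm'.
have mn : m ** n = m' ** n.
  rewrite -{1}nm'n !amulA -[m ** n ** m' ** n]amulA (CC (IC Imn) (IC Im'n)).
  by rewrite -!amulA (amulA n m n) nmn.
have nm : n ** m = n ** m'.
  rewrite -{1}nm'n -[_ ** n ** m]amulA (CC (IC Inm') (IC Inm)).
  by rewrite amulA nmn.
by rewrite -mnm mn -amulA nm amulA.
Qed.

Lemma is_daggerC n m : is_dagger C n m -> is_dagger C m n.
Proof. by case=> h1 h2 h3; split=> // c /h3[]. Qed.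

(** The component of [m] in the degree opposite to [n] has the same products with
[n] as [m], and these determine [m] since [m = m ** n ** m]. *)
Lemma dagger_degree gamma n m :
  Ag gamma n -> is_dagger C n m -> Ag gamma^-1%g m.
Proof.
move=> hn dnm; have [Imn Inm] := idempotent_dagger hn dnm.
have [mnm _ _] := dnm; set m' := comp gamma^-1%g m.
have one x : Ag 1%g x -> comp 1%g x = x.
  by move=> hx; rewrite (component_of_hom _ hx) eqxx.
have mn : m ** n = m' ** n.
  by rewrite -[LHS](one _ (subC (IC Imn))) -(mulVg gamma) (component_mulr _ _ hn).
have nm : n ** m = n ** m'.
  by rewrite -[LHS](one _ (subC (IC Inm))) -(mulgV gamma) (component_mull _ _ hn).
have hm' := component_hom gamma^-1%g m.
rewrite -mnm mn -amulA nm.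
by rewrite -[X in Ag X](mulg1 gamma^-1%g) -(mulgV gamma); apply/homM/homM.
Qed.

Lemma NstarP n gamma m : Ag gamma n -> is_dagger C n m -> N n.
Proof. by move=> hn dm; exists gamma => //; split=> //; split=> //; exists m. Qed.

Lemma daggerP n : N n -> is_dagger C n n†.
Proof.
by move=> [g _ [[_ [m _ dm]] _]]; rewrite /dagger; case: xgetP => [? _ //|/(_ m dm)].
Qed.

Lemma dagger_eq n m : N n -> is_dagger C n m -> n† = m.
Proof.
move=> Nn dm; have [g hn] := Nstar_hom Nn.
exact: dagger_unique_hom hn (daggerP Nn) dm.
Qed.

Lemma dagger_hom gamma n : N n -> Ag gamma n -> Ag gamma^-1%g n†.
Proof. by move=> Nn hn; exact: dagger_degree hn (daggerP Nn). Qed.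

Lemma N_dagger n : N n -> N n†.
Proof.
move=> Nn; have [g hn] := Nstar_hom Nn.
exact: NstarP (dagger_hom Nn hn) (is_daggerC (daggerP Nn)).
Qed.

Lemma daggerK n : N n -> n†† = n.
Proof. by move=> Nn; apply: dagger_eq; [exact: N_dagger|exact/is_daggerC/daggerP]. Qed.

Lemma mulNdN n : N n -> n ** n† ** n = n.
Proof. by move=> /daggerP[]. Qed.

Lemma muldNd n : N n -> n† ** n ** n† = n†.
Proof. by move=> /daggerP[]. Qed.

Lemma C_conjd n c : N n -> C c -> C (n† ** c ** n).
Proof. by move=> /daggerP[_ _ h] /h[]. Qed.

Lemma C_conj n c : N n -> C c -> C (n ** c ** n†).
Proof. by move=> /daggerP[_ _ h] /h[]. Qed.

Lemma I_source n : N n -> I (n† ** n).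
Proof.
move=> Nn; have [g hn] := Nstar_hom Nn.
by have [] := idempotent_dagger hn (daggerP Nn).
Qed.

Lemma I_range n : N n -> I (n ** n†).
Proof.
move=> Nn; have [g hn] := Nstar_hom Nn.
by have [] := idempotent_dagger hn (daggerP Nn).
Qed.

(** Elements of [C] can be moved across a normaliser, because [n ** n†] commutes
with them. *)
Lemma mulCN n c : N n -> C c -> c ** n = n ** (n† ** c ** n).
Proof.
move=> Nn Cc; rewrite !amulA (CC (IC (I_range Nn)) Cc).
by rewrite -(amulA c) mulNdN.
Qed.

Lemma mulNC n c : N n -> C c -> n ** c = n ** c ** n† ** n.
Proof.
by move=> Nn Cc; rewrite -!amulA (CC Cc (IC (I_source Nn))) !amulA mulNdN.
Qed.

Lemma I_conjd n e : N n -> I e -> I (n† ** e ** n).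
Proof.
move=> Nn [Ce ee]; split; first exact: C_conjd.
by rewrite -(amulA (n† ** e)) -mulCN// !amulA -(amulA n† e) ee.
Qed.

Lemma I_conj n e : N n -> I e -> I (n ** e ** n†).
Proof. by move=> Nn Ie; have := I_conjd (N_dagger Nn) Ie; rewrite daggerK. Qed.

Lemma is_daggerI e : I e -> is_dagger C e e.
Proof.
by move=> [Ce ee]; split; rewrite ?ee// => c Cc; split; apply: CM => //; exact: CM.
Qed.

Lemma I_N e : I e -> N e.
Proof. by move=> Ie; exact: NstarP (subC (IC Ie)) (is_daggerI Ie). Qed.

Lemma daggerI e : I e -> e† = e.
Proof. by move=> Ie; apply: dagger_eq; [exact: I_N|exact: is_daggerI]. Qed.

Lemma is_daggerM m n : N m -> N n -> is_dagger C (m ** n) (n† ** m†).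
Proof.
move=> Nm Nn; split=> [||c Cc].
- rewrite !amulA -(amulA n†) -(amulA _ n) -(amulA n†).
  rewrite (CC (IC (I_source Nm)) (IC (I_range Nn))) !amulA (muldNd Nn).
  by rewrite -2!(amulA n†) (muldNd Nm).
- rewrite !amulA -(amulA m) -(amulA _ m†) -(amulA m).
  rewrite (CC (IC (I_range Nn)) (IC (I_source Nm))) !amulA (mulNdN Nm).
  by rewrite -2!(amulA m) (mulNdN Nn).
- have := C_conjd Nn (C_conjd Nm Cc); have := C_conj Nm (C_conj Nn Cc).
  by rewrite !amulA.
Qed.

Lemma NM m n : N m -> N n -> N (m ** n).
Proof.
move=> Nm Nn; have [g hm] := Nstar_hom Nm; have [h hn] := Nstar_hom Nn.
exact: NstarP (homM hm hn) (is_daggerM Nm Nn).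
Qed.

Lemma daggerM m n : N m -> N n -> (m ** n)† = n† ** m†.
Proof. by move=> Nm Nn; apply: dagger_eq; [exact: NM|exact: is_daggerM]. Qed.

Lemma is_daggerZ r s n : N n -> r * s = 1 -> is_dagger C (r *: n) (s *: n†).
Proof.
move=> Nn rs; have sr : s * r = 1 by rewrite mulrC.
split=> [||c Cc].
- by rewrite !(amulZl, amulZr) !scalerA -mulrA ?rs ?sr mulr1 muldNd.
- by rewrite !(amulZl, amulZr) !scalerA -mulrA ?rs ?sr mulr1 mulNdN.
- rewrite !(amulZl, amulZr) !scalerA ?sr ?rs !scale1r.
  by split; [exact: C_conjd|exact: C_conj].
Qed.

Lemma NZ r s n : N n -> r * s = 1 -> N (r *: n).
Proof.
move=> Nn rs; have [g hn] := Nstar_hom Nn.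
exact: NstarP (homZ r hn) (is_daggerZ Nn rs).
Qed.

Lemma daggerZ r s n : N n -> r * s = 1 -> (r *: n)† = s *: n†.
Proof. by move=> Nn rs; apply: dagger_eq; [exact: NZ rs|exact: is_daggerZ]. Qed.

Lemma WT_N n t : N n -> n <> 0 -> t *: n = 0 -> t = 0.
Proof.
move=> Nn n0 tn; apply: (WT (I_source Nn)).
  by move=> nn; apply: n0; rewrite -(mulNdN Nn) -amulA nn amulr0.
by rewrite -amulZr tn amulr0.
Qed.

Lemma NMI n e : N n -> I e -> N (n ** e).
Proof. by move=> Nn Ie; apply: NM => //; exact: I_N. Qed.

Lemma NIM n e : N n -> I e -> N (e ** n).
Proof. by move=> Nn Ie; apply: NM => //; exact: I_N. Qed.

(** The natural partial order, in the form of restriction to an idempotent; see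
[sleP]. *)
Definition sle m n := N n /\ exists2 e, I e & m = n ** e.

Lemma sleP m n : N m -> N n -> nle C m n <-> sle m n.
Proof.
move=> Nm Nn; split=> [mn|[_ [e Ie ->]]].
  by split=> //; exists (m† ** m); rewrite ?amulA//; exact: I_source.
rewrite /nle daggerM ?(daggerI Ie)//; last exact: I_N.
rewrite !amulA -(amulA _ n†) -(amulA n) (CC (IC Ie) (IC (I_source Nn))).
by rewrite !amulA mulNdN// -amulA Iidem.
Qed.

Lemma sleNl m n : sle m n -> N m.
Proof. by move=> [Nn [e Ie ->]]; exact: NMI. Qed.

Lemma sleNr m n : sle m n -> N n.
Proof. by case. Qed.

Lemma sle_mulI n e : N n -> I e -> sle (n ** e) n.
Proof. by move=> Nn Ie; split=> //; exists e. Qed.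

Lemma sle_Imul n e : N n -> I e -> sle (e ** n) n.
Proof.
move=> Nn Ie; split=> //; exists (n† ** e ** n); first exact: I_conjd.
by rewrite (mulCN Nn (IC Ie)).
Qed.

Lemma sleE m n : sle m n -> exists2 e, I e & m = e ** n.
Proof.
move=> [Nn [e Ie ->]]; exists (n ** e ** n†); first exact: I_conj.
by rewrite {1}(mulNC Nn (IC Ie)).
Qed.

Lemma sle_refl n : N n -> sle n n.
Proof.
move=> Nn; split=> //; exists (n† ** n); first exact: I_source.
by rewrite amulA mulNdN.
Qed.

Lemma sle_trans n m p : sle m n -> sle n p -> sle m p.
Proof.
move=> [_ [e Ie ->]] [Np [f If ->]]; split=> //.
by exists (f ** e); [exact: IM|rewrite amulA].
Qed.

Lemma sle_mull x m n : N x -> sle m n -> sle (x ** m) (x ** n).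
Proof.
move=> Nx [Nn [e Ie ->]]; split; first exact: NM.
by exists e; rewrite ?amulA.
Qed.

Lemma sle_mulr x m n : N x -> sle m n -> sle (m ** x) (n ** x).
Proof.
move=> Nx mn; have Nn := sleNr mn; have [e Ie ->] := sleE mn.
by rewrite -amulA; apply: sle_Imul => //; exact: NM.
Qed.

Lemma sle_dagger m n : sle m n -> sle m† n†.
Proof.
move=> [Nn [e Ie ->]]; rewrite daggerM ?(daggerI Ie)//; last exact: I_N.
by apply: sle_Imul => //; exact: N_dagger.
Qed.

Lemma sleZ r s m n : r * s = 1 -> sle m n -> sle (r *: m) (r *: n).
Proof.
move=> rs [Nn [e Ie ->]]; split; first exact: NZ rs.
by exists e; rewrite ?amulZl.
Qed.

Lemma sle_source m n : sle m n -> m = n ** (m† ** m).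
Proof.
by move=> mn; rewrite amulA; apply/sleP => //; [exact: sleNl mn|exact: sleNr mn].
Qed.

Lemma sle_range m n : sle m n -> m = m ** m† ** n.
Proof.
move=> mn; have Nn := sleNr mn; have Nm := sleNl mn.
have := sle_source (sle_dagger mn); rewrite daggerK// => /(congr1 (dagger C)).
by rewrite daggerK// (daggerM (N_dagger Nn) (I_N (I_range Nm))) daggerK//
  (daggerI (I_range Nm)).
Qed.

(** ** The conditional expectation *)

(** The expectation of the unit component, extended by zero in the other
degrees, is a conditional expectation of the whole algebra. *)
Definition E a := P (comp 1%g a).

Lemma E_linear r a b : E (r *: a + b) = r *: E a + E b.
Proof.
have [[+ _ _ _] _ _] := expP.
by rewrite /E component_linear; apply; exact: component_hom.
Qed.

Lemma EC a : C (E a).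
Proof. by have [[_ + _ _] _ _] := expP; apply; exact: component_hom. Qed.

Lemma E_id c : C c -> E c = c.
Proof.
have [[_ _ + _] _ _] := expP => PC Cc.
by rewrite /E (component_of_hom _ (subC Cc)) eqxx PC.
Qed.

Lemma EZ r a : E (r *: a) = r *: E a.
Proof. by rewrite -[r *: a]addr0 E_linear (E_id C0) addr0. Qed.

Lemma comp1_mulC c a : C c -> comp 1%g (c ** a) = c ** comp 1%g a.
Proof. by move=> /subC hc; rewrite -(component_mull _ _ hc) mulg1. Qed.

Lemma comp1_Cmul c a : C c -> comp 1%g (a ** c) = comp 1%g a ** c.
Proof. by move=> /subC hc; rewrite -(component_mulr _ _ hc) mulg1. Qed.

Lemma E_mulC c a : C c -> E (c ** a) = c ** E a.
Proof.
have [[_ PC _ Pb] _ _] := expP => Cc; rewrite /E comp1_mulC//.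
have hc := subC Cc; have ha := component_hom 1%g a.
have hca := homM hc ha; rewrite mulg1 in hca.
have Pa := subC (PC _ ha); have hcPa := homM hc Pa; rewrite mulg1 in hcPa.
have [||e Ie he] := @local_units1
    [set c ** comp 1%g a; c ** P (comp 1%g a)].
- by rewrite finite_setU; split; exact: finite_set1.
- by move=> _ [|] ->.
have [_ <-] := he _ (or_introl erefl).
have [_ <-] := he _ (or_intror erefl).
exact: Pb _ _ _ Cc ha (IC Ie).
Qed.

Lemma E_Cmul c a : C c -> E (a ** c) = E a ** c.
Proof.
have [[_ PC _ Pb] _ _] := expP => Cc; rewrite /E comp1_Cmul//.
have hc := subC Cc; have ha := component_hom 1%g a.
have hca := homM ha hc; rewrite mulg1 in hca.
have Pa := subC (PC _ ha); have hcPa := homM Pa hc; rewrite mulg1 in hcPa.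
have [||e Ie he] := @local_units1
    [set comp 1%g a ** c; P (comp 1%g a) ** c].
- by rewrite finite_setU; split; exact: finite_set1.
- by move=> _ [|] ->.
have [<- _] := he _ (or_introl erefl).
have [<- _] := he _ (or_intror erefl).
rewrite !amulA; exact: Pb _ _ _ (IC Ie) ha Cc.
Qed.

Lemma normaliser1P n : normalisers (Ag 1%g) C n <-> N n /\ Ag 1%g n.
Proof.
split=> [[hn [m hm dm]]|[Nn hn]]; first by split=> //; exact: NstarP hn dm.
split=> //; exists n†; last exact: daggerP.
by rewrite -invg1; exact: dagger_hom.
Qed.

Lemma E_N n : N n -> exists2 e, I e & E n = e ** n.
Proof.
move=> Nn; have [g hn] := Nstar_hom Nn; rewrite /E (component_of_hom _ hn).
case: eqP => [e1|_]; last first.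
  by exists 0; [exact: I0|rewrite amul0r; have := E_id C0; rewrite /E component0].
have [_ _ /(_ n)] := expP; case; first by apply/normaliser1P; rewrite e1.
by move=> e Ie [_ ->]; exists e.
Qed.

Lemma E_faithful a : Ag 1%g a -> a <> 0 -> exists2 n, N n & E (n ** a) <> 0.
Proof.
move=> ha a0; have [_ + _] := expP => /(_ _ ha a0)[n /normaliser1P[Nn hn] nz].
exists n => //; rewrite /E (component_of_hom _ (homM hn ha)) mulg1 eqxx.
exact: nz.
Qed.

(** A normaliser lying in [C] is invertible in [C] under its support: its
dagger commutes with [C] and is therefore fixed by the expectation. *)
Lemma C_dagger k : C k -> N k -> C k†.
Proof.
move=> Ck Nk; have Is := IC (I_source Nk); have Ir := IC (I_range Nk).
have -> : k† = E k†; last exact: EC.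
have Er : E k† = E k† ** (k ** k†) by rewrite -E_Cmul// amulA muldNd.
by rewrite Er amulA -E_Cmul// E_id// muldNd.
Qed.

(** * Ultrafilters of normalisers *)

Local Notation Sig := (Sigma Ag C).
Local Notation "U ∋ n" := (ucarrier U n) (at level 70).
Implicit Types (U V W : Sig).

Lemma nfilterP (X : set A) : is_nfilter Ag C X <->
  [/\ X !=set0, forall m, X m -> N m /\ m <> 0,
      forall m n, X m -> sle m n -> X n
    & forall m n, X m -> X n -> exists p, [/\ X p, sle p m & sle p n]].
Proof.
split=> [[X0 XN Xup Xdir]|[X0 XN Xup Xdir]].
- have XN' m : X m -> N m /\ m <> 0 by move=> Xm; exact: (XN _ Xm).
  split=> //.
    move=> m n Xm mn; rewrite Xup; split; first exact: sleNr mn.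
    by exists m => //; apply/sleP => //; [have [] := XN' _ Xm|exact: sleNr mn].
  move=> m n Xm Xn; have [p [Xp pm pn]] := Xdir _ _ Xm Xn.
  have [[Np _] [Nm _] [Nn _]] := And3 (XN' _ Xp) (XN' _ Xm) (XN' _ Xn).
  by exists p; split=> //; apply/sleP.
- split=> //.
    apply/seteqP; split=> m => [Xm|[Nm [n Xn nm]]].
      have [Nm _] := XN _ Xm; split=> //; exists m => //.
      by apply/sleP => //; exact: sle_refl.
    by apply: (Xup n) => //; apply/sleP => //; have [] := XN _ Xn.
  move=> m n Xm Xn; have [p [Xp pm pn]] := Xdir _ _ Xm Xn.
  by exists p; split=> //; apply/sleP; by [have [] := XN _ Xm|
    have [] := XN _ Xn|have [] := XN _ Xp|].
Qed.

Lemma nfilter_base (B : set A) : B !=set0 ->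
    (forall b, B b -> N b /\ b <> 0) ->
    (forall b b', B b -> B b' -> exists c, [/\ B c, sle c b & sle c b']) ->
  is_nfilter Ag C [set m | exists2 b, B b & sle b m].
Proof.
move=> [b0 Bb0] BN Bdir; apply/nfilterP; split.
- by exists b0, b0 => //; apply: sle_refl; have [] := BN _ Bb0.
- move=> m [b Bb bm]; split; first exact: sleNr bm.
  have [_ b_neq0] := BN _ Bb; have [_ [e _ be]] := bm.
  by move=> m0; apply: b_neq0; rewrite be m0 amul0r.
- by move=> m n [b Bb bm] mn; exists b => //; exact: sle_trans bm mn.
- move=> m n [b Bb bm] [b' Bb' bn]; have [c [Bc cb cb']] := Bdir _ _ Bb Bb'.
  exists c; split; [exists c => //|exact: sle_trans cb bm|exact: sle_trans cb' bn].
  by apply: sle_refl; exact: sleNl cb.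
Qed.

Lemma ufN U n : U ∋ n -> N n.
Proof. by have [/nfilterP[_ h _ _] _] := SigmaP U; case/h. Qed.

Lemma uf_neq0 U n : U ∋ n -> n <> 0.
Proof. by have [/nfilterP[_ h _ _] _] := SigmaP U; case/h. Qed.

Lemma uf_up U m n : U ∋ m -> sle m n -> U ∋ n.
Proof. by have [/nfilterP[_ _ h _] _] := SigmaP U; exact: h. Qed.

Lemma uf_dir U m n : U ∋ m -> U ∋ n -> exists p, [/\ U ∋ p, sle p m & sle p n].
Proof. by have [/nfilterP[_ _ _ h] _] := SigmaP U; exact: h. Qed.

Lemma uf_ex U : exists n, U ∋ n.
Proof. by have [/nfilterP[] ] := SigmaP U. Qed.

Lemma uf_eq U V : (forall n, U ∋ n -> V ∋ n) -> U = V.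
Proof.
move=> UV; apply: val_inj => /=; have [_ Umax] := SigmaP U.
by rewrite (Umax V)//; have [] := SigmaP V.
Qed.

Lemma Sigma_ex (X : set A) : is_nultrafilter Ag C X ->
  exists2 U : Sig, ucarrier U = X & forall n, U ∋ n <-> X n.
Proof. by move=> uX; exists (MkSigma (asboolT uX)). Qed.

(** Maximality in the form in which it is used: the elements of a filter base
finer than an ultrafilter belong to that ultrafilter. *)
Lemma uf_base U (B : set A) : (forall b, B b -> N b /\ b <> 0) ->
    (forall b b', B b -> B b' -> exists c, [/\ B c, sle c b & sle c b']) ->
    (forall u, U ∋ u -> exists2 b, B b & sle b u) ->
  forall b, B b -> U ∋ b.
Proof.
move=> BN Bdir UB b Bb; have [_ Umax] := SigmaP U.
rewrite -(Umax [set m | exists2 b, B b & sle b m]).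
- by exists b => //; apply: sle_refl; have [] := BN _ Bb.
- by apply: nfilter_base => //; exists b.
- by move=> u /UB.
Qed.

Lemma sub_mulI n e : N n -> I e ->
  n - n ** e = n ** (n† ** n - n† ** n ** e).
Proof. by move=> Nn Ie; rewrite amulBr !amulA mulNdN. Qed.

Lemma sle_sub n e : N n -> I e -> sle (n - n ** e) n.
Proof.
move=> Nn Ie; rewrite sub_mulI//; apply: sle_mulI => //.
by apply: IB => //; exact: I_source.
Qed.

Lemma sle_subr p n e : I e -> sle p n -> p ** e = 0 -> sle p (n - n ** e).
Proof.
move=> Ie pn pe; split; first exact: sleNl (sle_sub (sleNr pn) Ie).
have [_ [f If pf]] := pn; exists f => //.
rewrite amulBl -amulA (CC (IC Ie) (IC If)) amulA -pf.
by rewrite pe subr0.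
Qed.

(** An ultrafilter decides every idempotent: if [e] kills no element of [U], then
the products [m ** e] form a filter base finer than [U]; otherwise the elements
of [U] below both [n] and an element killed by [e] lie below [n - n ** e]. *)
Lemma uf_mulI U n e : U ∋ n -> I e -> U ∋ n ** e \/ U ∋ n - n ** e.
Proof.
move=> Un Ie; have [Ue|/existsNP[m /not_implyP[Um /contrapT me]]] :=
  pselect (forall m, U ∋ m -> m ** e <> 0); [left|right].
  apply: (@uf_base U [set m ** e | m in U]); last by exists n.
  - move=> _ [m Um <-]; split; last exact: Ue.
    by apply: NMI => //; exact: ufN Um.
  - move=> _ _ [m Um <-] [m' Um' <-]; have [p [Up pm pm']] := uf_dir Um Um'.
    by exists (p ** e); split; [exists p|apply: sle_mulr => //; exact: I_N..].
  - move=> u Uu; exists (u ** e); first by exists u.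
    by apply: sle_mulI => //; exact: ufN Uu.
have [p [Up pm pn]] := uf_dir Um Un; apply: uf_up Up _; apply: sle_subr => //.
by have [f _ ->] := sleE pm; rewrite -amulA me amulr0.
Qed.

Lemma uf_Imul U n e : U ∋ n -> I e -> U ∋ e ** n \/ U ∋ n - e ** n.
Proof.
by move=> Un Ie; rewrite (mulCN (ufN Un) (IC Ie)); apply: uf_mulI => //;
  apply: I_conjd => //; exact: ufN Un.
Qed.

(** The principal filter of [n] is a filter, so Zorn's lemma applies to the
filters containing [n]; the empty set is thrown in because the union of the
empty chain has to be allowed. *)
Lemma uf_exists n : N n -> n <> 0 -> exists U : Sig, U ∋ n.
Proof.
move=> Nn n0.
pose Q X := X = set0 \/ (is_nfilter Ag C X /\ X n).
have [F QF Fchain|X [QX Xmax]] := @Zorn_bigcup A Q.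
  have [FX|nF] := pselect (exists2 X, F X & X !=set0); last first.
    left; apply/seteqP; split=> // m [X FX Xm].
    by apply: nF; exists X => //; exists m.
  have FP X m : F X -> X m -> is_nfilter Ag C X /\ X n.
    by move=> FX' Xm; have [X0|//] := QF _ FX'; move: Xm; rewrite X0.
  right; have [X FX' [m Xm]] := FX; split; last first.
    by exists X => //; have [] := FP _ _ FX' Xm.
  apply/nfilterP; split; first by exists m, X.
  - by move=> p [Y FY Yp]; have [/nfilterP[_ h _ _] _] := FP _ _ FY Yp; exact: h.
  - move=> p q [Y FY Yp] pq; exists Y => //.
    by have [/nfilterP[_ _ h _] _] := FP _ _ FY Yp; exact: h Yp pq.
  - move=> p q [Y FY Yp] [Z FZ Zq].
    have [T [FT Tp Tq]] : exists T, [/\ F T, T p & T q].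
      by have [YZ|ZY] := Fchain _ _ FY FZ; [exists Z|exists Y]; split=> //;
        [exact: YZ|exact: ZY].
    have [/nfilterP[_ _ _ Tdir] _] := FP _ _ FT Tp.
    by have [u [Tu up uq]] := Tdir _ _ Tp Tq; exists u; split=> //; exists T.
have [X0|[fX Xn]] := QX.
  pose Y := [set m | exists2 b, [set n] b & sle b m].
  exfalso; apply: (Xmax Y).
    rewrite X0; split=> // /(_ n); apply.
    by exists n => //; exact: sle_refl.
  right; split; last by exists n => //; exact: sle_refl.
  apply: nfilter_base; first by exists n.
    by move=> _ ->.
  by move=> _ _ -> ->; exists n; split=> //; exact: sle_refl.
have [|U _ UX] := @Sigma_ex X; last by exists U; apply/UX.
split=> // V fV XV; apply/seteqP; split=> //.
apply: contrapT => VX; apply: (Xmax V); first by split.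
by right; split=> //; exact: XV.
Qed.

(** * Scalar values of elements at ultrafilters *)

(** Elements of [C] are locally scalars, being combinations of idempotents. *)
Lemma uf_scalar U n c : C c -> U ∋ n ->
  exists p r, [/\ U ∋ p, sle p n & p ** c = r *: p].
Proof.
move=> Cc Un.
suff [_ [m [r [Um mc]]]] : C c /\ exists m r, U ∋ m /\ m ** c = r *: m.
  have [p [Up pm pn]] := uf_dir Um Un; exists p, r; split=> //.
  by have [e _ ->] := sleE pm; rewrite -amulA mc amulZr.
move: c Cc; apply: C_span_ind.
  by split; [exact: C0|exists n, 0; rewrite amulr0 scale0r].
move=> r e c Ie [Cc [m [s [Um ms]]]]; split; first exact: CD (CZ r (IC Ie)) Cc.
have [Ume|Umd] := uf_mulI Um Ie.
  exists (m ** e), (r + s); split=> //.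
  rewrite amulDr amulZr -!amulA (Iidem Ie) (CC (IC Ie) Cc) (amulA m c) ms.
  by rewrite amulZl -scalerDl.
exists (m - m ** e), s; split=> //.
rewrite amulDr amulZr !amulBl -!amulA (Iidem Ie) subrr scaler0 add0r.
by rewrite (CC (IC Ie) Cc) (amulA m c) ms amulZl scalerBr.
Qed.

(** For a unit ultrafilter and [a] in [C] the equation reads [e ** a = r *: e] with
[e] an idempotent of [U]. *)
Definition has_value a U r := exists2 n, U ∋ n & E (n† ** a) = r *: (n† ** n).

Definition value a U : R := xget 0 [set r | has_value a U r].

(** The defining equation of the value passes to smaller normalisers, so that two
of them can be compared at a common lower bound. *)
Lemma expectation_sle m n a r : sle m n -> E (n† ** a) = r *: (n† ** n) ->
  E (m† ** a) = r *: (m† ** m).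
Proof.
move=> [Nn [e Ie ->]] En; rewrite daggerM ?(daggerI Ie)//; last exact: I_N.
rewrite -amulA (E_mulC _ (IC Ie)) En amulZr -!amulA (amulA n†).
by rewrite (CC (IC (I_source Nn)) (IC Ie)) (amulA e e) Iidem.
Qed.

Lemma source_neq0 n : N n -> n <> 0 -> n† ** n <> 0.
Proof. by move=> Nn n0 nn; apply: n0; rewrite -(mulNdN Nn) -amulA nn amulr0. Qed.

Lemma has_value_unique a U r s : has_value a U r -> has_value a U s -> r = s.
Proof.
move=> [n Un En] [m Um Em]; have [p [Up pn pm]] := uf_dir Un Um.
have := expectation_sle pm Em; rewrite (expectation_sle pn En).
have Np := ufN Up.
move=> /eqP; rewrite -subr_eq0 -scalerBl => /eqP rs; apply/eqP.
rewrite -subr_eq0; apply/eqP; apply: WT rs; first exact: I_source.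
by apply: source_neq0 => //; exact: uf_neq0 Up.
Qed.

Lemma E_dagger_sle p n a : sle p n -> E (p† ** a) = p† ** p ** E (n† ** a).
Proof.
move=> [Nn [e Ie ->]]; rewrite daggerM ?(daggerI Ie)//; last exact: I_N.
have -> : e ** n† ** (n ** e) = e ** (n† ** n).
  rewrite -!amulA (amulA n†) (CC (IC (I_source Nn)) (IC Ie)).
  by rewrite (amulA e e) Iidem.
rewrite -amulA (E_mulC _ (IC Ie)) -[in RHS]amulA; congr (_ ** _).
by rewrite -E_mulC ?amulA ?muldNd//; exact/IC/I_source.
Qed.

Lemma has_value_ex a U n : U ∋ n ->
  exists p r, [/\ U ∋ p, sle p n & E (p† ** a) = r *: (p† ** p)].
Proof.
move=> Un; have Nn := ufN Un.
have [p [r [Up pn pr]]] := uf_scalar (EC (n† ** a)) Un.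
exists p, r; split=> //; have Np := ufN Up.
by rewrite (E_dagger_sle _ pn) -amulA pr amulZr.
Qed.

Lemma value_eq a U n r : U ∋ n -> E (n† ** a) = r *: (n† ** n) -> value a U = r.
Proof.
move=> Un En; have vr : has_value a U r by exists n.
by rewrite /value; case: xgetP => [s _ vs|/(_ r vr)//]; exact: has_value_unique vs vr.
Qed.

Lemma value_ex a U n : U ∋ n ->
  exists p, [/\ U ∋ p, sle p n & E (p† ** a) = value a U *: (p† ** p)].
Proof.
move=> Un; have [p [r [Up pn Ep]]] := has_value_ex a Un.
by exists p; rewrite (value_eq Up Ep).
Qed.

Lemma value_linear r a b U : value (r *: a + b) U = r * value a U + value b U.
Proof.
have [n Un] := uf_ex U; have [p [Up _ Ep]] := value_ex a Un.
have [q [Uq qp Eq]] := value_ex b Up.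
apply: (value_eq Uq); rewrite amulDr amulZr E_linear Eq.
by rewrite (expectation_sle qp Ep) scalerA -scalerDl.
Qed.

Lemma value0 U : value 0 U = 0.
Proof.
have := value_linear 1 0 0 U.
rewrite scale1r mul1r addr0 => /(congr1 (fun z => z - value 0 U)).
by rewrite subrr addrK.
Qed.

Lemma value_locally_constant a U :
  exists2 n, U ∋ n & forall V, V ∋ n -> value a V = value a U.
Proof.
have [n Un] := uf_ex U; have [p [Up _ Ep]] := value_ex a Un.
by exists p => // V Vp; exact: value_eq Vp Ep.
Qed.

Lemma value_N_unit U n r s : r * s = 1 -> N n -> U ∋ s *: n -> value n U = r.
Proof.
move=> rs Nn Un; have sr : s * r = 1 by rewrite mulrC.
apply: (value_eq Un); rewrite (daggerZ Nn sr) !(amulZl, amulZr).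
rewrite (E_id (CZ _ (IC (I_source Nn)))) !scalerA.
by congr (_ *: _); rewrite -mulrA ?sr ?rs ?mulr1.
Qed.

Lemma value_N U n : U ∋ n -> value n U = 1.
Proof.
by move=> Un; apply: (@value_N_unit _ _ _ 1); rewrite ?mulr1 ?scale1r//; exact: ufN Un.
Qed.

(** Where a normaliser [n] has nonzero value, that value is a unit [r], and the
ultrafilter contains [r^-1 n]: near the ultrafilter the expectation of [m† n],
with [m] in the ultrafilter, is a scalar which is a normaliser, so invertible. *)
Lemma value_N_cases U n : N n ->
  value n U = 0 \/ exists r s, [/\ r * s = 1, U ∋ s *: n & value n U = r].
Proof.
move=> Nn; have [m0 Um0] := uf_ex U; have [m [Um _ Em]] := value_ex n Um0.
have Nm := ufN Um; set r := value n U in Em *.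
have Nk0 : N (m† ** n) by apply: NM => //; exact: N_dagger.
have [f If Ef] := E_N Nk0; set k := E (m† ** n) in Em Ef.
have Ck : C k by exact: EC.
have Nk : N k by rewrite Ef; exact: NIM.
have Cd := C_dagger Ck Nk.
have [h hE] : exists h, h = k† ** k by exists (k† ** k).
have Ih : I h by rewrite hE; exact: I_source.
have mk p : sle p m -> p ** k = r *: p.
  move=> pm; rewrite Em amulZr; have [e _ ->] := sleE pm.
  by rewrite -amulA (amulA m) mulNdN.
have kh : k ** h = k by rewrite hE amulA mulNdN.
have [Umh|Umd] := uf_mulI Um Ih; last first.
  (* off the support of [k] the value vanishes *)
  left; have dm := sle_sub Nm Ih; have := mk _ dm; set d := m - m ** h in Umd dm *.
  have dk : d ** k = 0.
    by rewrite -kh (CC Ck (IC Ih)) amulA amulBl -(amulA m) Iidem// subrr amul0r.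
  by rewrite dk => /esym; apply: WT_N; [exact: ufN Umd|exact: uf_neq0 Umd].
right; have [p [s [Up pmh ps]]] := uf_scalar Cd Umh.
have pm : sle p m by apply: sle_trans pmh _; exact: sle_mulI.
have ph : p ** h = p by have [e _ ->] := sleE pmh; rewrite -!amulA Iidem.
have rs : r * s = 1.
  have : p ** h = (s * r) *: p by rewrite hE amulA ps amulZl (mk _ pm) scalerA.
  rewrite ph -[p in LHS]scale1r => /eqP; rewrite -subr_eq0 -scalerBl => /eqP.
  move=> /(WT_N (ufN Up) (uf_neq0 Up)) /eqP; rewrite subr_eq0 mulrC.
  by move=> /eqP.
have rp : sle (r *: p) n.
  rewrite -(mk _ pm) Ef; have [_ [e Ie ->]] := pm.
  have -> : m ** e ** (f ** (m† ** n)) = m ** (e ** f) ** m† ** n.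
    by rewrite !amulA.
  by apply: sle_Imul => //; apply: I_conj => //; exact: IM.
have sr : s * r = 1 by rewrite mulrC.
have Usn : U ∋ s *: n.
  by apply: uf_up Up _; rewrite -[p]scale1r -sr -scalerA; exact: sleZ sr rp.
by exists r, s.
Qed.

(** * Separation of elements by ultrafilters *)

(** The idempotents in an expression of [c] are decided one after the other, each
time keeping a part of [e] on which [d] does not vanish. *)
Lemma C_refine c e d : C c -> I e -> e ** d <> 0 ->
  exists f r, [/\ I f, sle f e, f ** d <> 0 & f ** c = r *: f].
Proof.
move=> Cc; move: c Cc e; apply: C_span_ind.
  move=> e Ie ed; exists e, 0; split=> //; first by apply/sle_refl/I_N.
  by rewrite amulr0 scale0r.
move=> r g c Ig ih e Ie ed.
have [f [s [If fe fd fc]]] := ih _ Ie ed.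
have [fgd|fgd] := pselect (f ** g ** d = 0).
  exists (f - f ** g), s; split; first exact: IB.
  - by apply: sle_trans fe; apply: sle_sub => //; exact: I_N.
  - by rewrite amulBl fgd subr0.
  rewrite amulDr amulZr !amulBl -amulA Iidem// subrr scaler0 add0r.
  by rewrite (CC (IC If) (IC Ig)) -amulA fc amulZr scalerBr.
exists (f ** g), (r + s); split=> //; first exact: IM.
  by apply: sle_trans fe; apply: sle_mulI => //; exact: I_N.
rewrite amulDr amulZr -amulA Iidem// (CC (IC If) (IC Ig)) -(amulA g f c) fc.
by rewrite amulZr -scalerDl.
Qed.

(** The element [E (n† ** a)] of [C] is a nonzero scalar on some idempotent [f]
below the source of [n], and [n ** f] lies in an ultrafilter. This is the common
core of the injectivity of [phi] and of the hat map. *)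
Lemma value_separates a n : N n -> E (n† ** a) <> 0 ->
  exists2 U, U ∋ n & value a U <> 0.
Proof.
move=> Nn E0; set c := E (n† ** a) in E0.
have cE : n† ** n ** c = c.
  by rewrite -E_mulC ?amulA ?muldNd//; exact/IC/I_source.
have Inn := I_source Nn.
have [|f [r [If fs fc fr]]] := C_refine (EC (n† ** a)) Inn (d := c).
  by rewrite cE.
have r0 : r <> 0 by move=> r0; move: fc; rewrite fr r0 scale0r.
have f0 : f <> 0 by move=> f0; move: fc; rewrite f0 amul0r.
have fE : n† ** n ** f = f.
  by have [_ [e _ ->]] := fs; rewrite (amulA (n† ** n)) Iidem.
have [||U Unf] := @uf_exists (n ** f); first exact: NMI.
  by move=> nf; apply: f0; rewrite -fE -amulA nf amulr0.
exists U; first by apply: uf_up Unf _; exact: sle_mulI.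
rewrite (value_eq Unf (r := r))//.
rewrite daggerM ?(daggerI If)//; last exact: I_N.
rewrite -!amulA (E_mulC _ (IC If)) -/c fr; congr (_ *: _).
by rewrite (amulA n†) fE Iidem.
Qed.

(** If [n† a = 0] for all [n] of the degree of [a], then all the range
idempotents of the normalisers spanning that degree kill [a]; so does their
join, which acts as a unit on [a]. *)
Lemma dagger_mul_neq0 gamma a : Ag gamma a -> a <> 0 ->
  exists n, [/\ N n, Ag gamma n & n† ** a <> 0].
Proof.
move=> ha; apply: contra_notP => nex.
have kill n : N n -> Ag gamma n -> n† ** a = 0.
  by move=> Nn hn; apply: contrapT => na; apply: nex; exists n.
pose Q b := exists e, [/\ I e, e ** a = 0 & e ** comp gamma b = comp gamma b].
suff H b : Q b.
  by have [e [_ <- ]] := H a; rewrite (component_of_hom _ ha) eqxx.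
elim/Nstar_span_ind: b => [|r n b Nn [e [Ie ea eb]]].
  by exists 0; split; rewrite ?component0 ?amul0r//; exact: I0.
have [d hn] := Nstar_hom Nn; rewrite /Q component_linear (component_of_hom _ hn).
case: eqP => [gd|_]; last by exists e; rewrite scaler0 add0r.
set f := n ** n†; have If : I f by exact: I_range.
have fa : f ** a = 0 by rewrite -amulA kill ?gd// amulr0.
exists (e + (f - f ** e)); split; first exact: IU.
  by rewrite amulDl amulBl -amulA ea fa amulr0 subrr addr0.
have fn : f ** n = n by rewrite mulNdN.
have {}eb x : comp gamma b = x -> (e + (f - f ** e)) ** x = x.
  by move=> <-; rewrite amulDl amulBl -amulA !eb subrr addr0.
rewrite amulDr (eb _ erefl) amulZr; congr (_ *: _ + _).
rewrite amulDl amulBl fn (CC (IC If) (IC Ie)) -amulA fn.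
by rewrite addrC subrK.
Qed.

(** Faithfulness is available in degree one only; [dagger_mul_neq0] moves a
nonvanishing component of [a] there. *)
Lemma value_injective a : (forall U, value a U = 0) -> a = 0.
Proof.
move=> va; apply: contrapT => a0.
have [gamma ag0] : exists gamma, comp gamma a <> 0.
  apply/existsNP => ag; apply: a0.
  by have [_ _ ->] := decomposition_component a; rewrite fsbig1.
have [n [Nn hn na]] := dagger_mul_neq0 (component_hom gamma a) ag0.
have hdn := dagger_hom Nn hn.
have hna := homM hdn (component_hom gamma a); rewrite mulVg in hna.
have [m Nm Em] := E_faithful hna na.
have [l hm] := Nstar_hom Nm.
have [l1|l1] := eqVneq l 1%g; last first.
  apply: Em; rewrite /E (component_of_hom _ (homM hm hna)) mulg1.
  by rewrite eq_sym (negbTE l1) (_ : P 0 = 0)//; have := E_id C0;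
    rewrite /E component0.
have Np : N (n ** m†) by apply: NM => //; exact: N_dagger.
have pE : (n ** m†)† = m ** n† by rewrite daggerM ?daggerK//; exact: N_dagger.
have [|U _] := @value_separates a (n ** m†) Np; last by rewrite va.
rewrite pE -amulA; rewrite /E in Em *.
suff -> : comp 1%g (m ** (n† ** a)) = comp 1%g (m ** (n† ** comp gamma a)) by [].
rewrite l1 in hm.
rewrite -{1 2}[1%g]mulg1 !(component_mull _ _ hm) -(mulVg gamma).
rewrite !(component_mull _ _ hdn).
by rewrite (component_of_hom _ (component_hom gamma a)) eqxx.
Qed.

(** * The topology of the ultrafilter space *)

Local Notation Vs := (Vset Ag C).

Lemma open_SigmaP (X : set Sig) :
  open X <-> forall U, X U -> exists2 n, U ∋ n & Vs n `<=` X.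
Proof.
split=> [[D sD <-] U [n Dn Un]|XV].
  by exists n => // V Vn; exists n.
exists [set n : nu_pointed A | N n /\ Vs n `<=` X]; first by move=> n [].
apply/seteqP; split=> [U [n [Nn nX] Un]|U XU]; first exact: nX.
by have [n Un nX] := XV _ XU; exists n => //; split=> //; exact: ufN Un.
Qed.

Lemma open_Vset n : open (Vs n).
Proof. by apply/open_SigmaP => U Un; exists n. Qed.

Lemma nbhs_SigmaP U (X : set Sig) :
  nbhs U X <-> exists2 n, U ∋ n & Vs n `<=` X.
Proof.
rewrite nbhsE; split=> [[Y [oY YU] YX]|[n Un nX]].
  have /open_SigmaP/(_ _ YU)[n Un nY] := oY.
  by exists n => //; exact: subset_trans YX.
by exists (Vs n) => //; split=> //; exact: open_Vset.
Qed.

Lemma sle_sub_eq0 q n e : I e -> sle q (n ** e) -> sle q (n - n ** e) -> q = 0.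
Proof.
move=> Ie [_ [f If qf]] [_ [g Ig qg]].
have <- : q ** e = q.
  by rewrite qf -!amulA (CC (IC If) (IC Ie)) (amulA e) Iidem.
rewrite qg -amulA (CC (IC Ig) (IC Ie)) amulA amulBl -(amulA n) Iidem//.
by rewrite subrr amul0r.
Qed.

Lemma Vset_meet n e f U : I e -> I f ->
  U ∋ n ** e -> U ∋ n ** f -> U ∋ n ** e ** f.
Proof.
move=> Ie If Ue Uf; have [p [Up pe [_ [g Ig pg]]]] := uf_dir Ue Uf.
apply: uf_up Up _; have <- : p ** f = p.
  by rewrite pg -!amulA (CC (IC Ig) (IC If)) (amulA f) Iidem.
by apply: sle_mulr => //; exact: I_N.
Qed.

(** A topological ultrafilter [F] on [Vset n] singles out the restrictions
[n ** e] of [n] with [Vset (n ** e)] in [F]; as [Vset n] is the disjoint union of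
[Vset (n ** e)] and [Vset (n - n ** e)], these restrictions generate an
ultrafilter of normalisers, the limit of [F]. *)
Lemma compact_Vset n : N n -> compact (Vs n).
Proof.
move=> Nn; rewrite compact_ultra => F uF Fn.
pose B := [set m | exists e, [/\ I e, m = n ** e & F (Vs m)]].
have BN b : B b -> N b /\ b <> 0.
  move=> [e [Ie -> Fb]]; split; first exact: NMI.
  move=> b0; have [U Ub] := filter_ex Fb.
  by apply: (uf_neq0 Ub).
have Bdir b b' : B b -> B b' -> exists c, [/\ B c, sle c b & sle c b'].
  move=> [e [Ie -> Fe]] [f [If -> Ff]]; exists (n ** e ** f); split.
  - exists (e ** f); split; [exact: IM|by rewrite amulA|].
    apply: filterS (filterI Fe Ff) => U [Ue Uf].
    exact: Vset_meet.
  - by apply: sle_mulI => //; exact: NMI.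
  - rewrite -amulA (CC (IC Ie) (IC If)) amulA.
    by apply: sle_mulI => //; exact: NMI.
have Bn : B n.
  exists (n† ** n); split=> //; first exact: I_source.
  by rewrite amulA mulNdN.
have fX := nfilter_base (ex_intro _ _ Bn) BN Bdir.
have [|U _ UX] := @Sigma_ex [set m | exists2 b, B b & sle b m].
  split=> // V fV XV; apply/seteqP; split=> // m Vm.
  have /nfilterP[_ VN Vup Vdir] := fV.
  have BV b : B b -> V b.
    by move=> Bb; apply: XV; exists b => //; apply/sle_refl; have [] := BN _ Bb.
  have [p [Vp pm pn]] := Vdir _ _ Vm (BV _ Bn).
  have [_ [e Ie pe]] := pn; exists p => //; exists e; split=> //.
  have [//|nFp] := in_ultra_setVsetC (Vs p) uF; exfalso.
  have Fd : F (Vs (n - n ** e)).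
    apply: filterS (filterI Fn nFp) => W [Wn nWp].
    by have [We|//] := uf_mulI Wn Ie; case: nWp; rewrite pe.
  have Bd : B (n - n ** e).
    exists (n† ** n - n† ** n ** e); split=> //; last exact: sub_mulI.
    by apply: IB => //; exact: I_source.
  have [q [Vq qp qd]] := Vdir _ _ Vp (BV _ Bd); have [_ q0] := VN _ Vq.
  by apply: q0; rewrite pe in qp; exact: sle_sub_eq0 qp qd.
exists U; split; first by apply/UX; exists n => //; exact: sle_refl.
move=> X /nbhs_SigmaP[m /UX[b [e [Ie be Fb]] bm] mX].
by apply: filterS Fb => V Vb; apply: mX; exact: uf_up Vb bm.
Qed.

Lemma Sigma0P U : Sigma0 Ag C U <-> exists2 e, I e & U ∋ e.
Proof. by split=> [[e [Ue Ie]]|[e Ie Ue]]; exists e. Qed.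

Lemma locally_constant_value a : locally_constant (value a).
Proof.
move=> U; have [n Un vn] := value_locally_constant a U.
by apply/nbhs_SigmaP; exists n.
Qed.

Lemma locally_constant_open (f : Sig -> R) (D : set R) :
  locally_constant f -> open (f @^-1` D).
Proof.
move=> lf; rewrite openE => U DU; rewrite /interior.
by apply: filterS (lf U) => V /= ->.
Qed.

Lemma closed_supp (f : Sig -> R) : locally_constant f -> closed (supp f).
Proof.
move=> lf; rewrite (_ : supp f = ~` (f @^-1` [set 0])).
  by apply: open_closedC; exact: locally_constant_open.
by apply/seteqP; rewrite /supp; split=> U /= /eqP.
Qed.

(** ** Rescaling *)

Lemma insubdS U (X : set A) :
  is_nultrafilter Ag C X -> ucarrier (insubd U X) = X.
Proof.
by move=> uX; have := val_insubd U X; rewrite asboolT.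
Qed.

(** Used for the two order isomorphisms of the normalisers behind the groupoid:
the dagger and the multiplication by a unit of [R]. *)
Lemma nfilter_iso (f g : A -> A) (X : set A) : g 0 = 0 ->
    (forall m, N m -> g (f m) = m) -> (forall m, N m -> f (g m) = m) ->
    (forall m n, sle m n -> sle (f m) (f n)) ->
    (forall m n, sle m n -> sle (g m) (g n)) ->
  is_nfilter Ag C X -> is_nfilter Ag C [set f m | m in X].
Proof.
move=> g0 fK gK fs gs /nfilterP[[x Xx] XN Xup Xdir]; apply/nfilterP; split.
- by exists (f x), x.
- move=> _ [m /XN[Nm m0] <-]; split; first by apply: sleNl (fs _ _ (sle_refl Nm)).
  by move=> fm; apply: m0; rewrite -(fK _ Nm) fm.
- move=> _ n [m Xm <-] mn; have [Nm _] := XN _ Xm; exists (g n).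
    by apply: Xup Xm _; rewrite -{1}(fK _ Nm); exact: gs.
  by rewrite gK//; exact: sleNr mn.
- move=> _ _ [m Xm <-] [n Xn <-]; have [p [Xp pm pn]] := Xdir _ _ Xm Xn.
  by exists (f p); split; [exists p|exact: fs..].
Qed.

Section OrderIsomorphism.
Variables f g : A -> A.
Hypotheses (f0 : f 0 = 0) (g0 : g 0 = 0).
Hypotheses (fK : forall m, N m -> g (f m) = m)
  (gK : forall m, N m -> f (g m) = m).
Hypotheses (fs : forall m n, sle m n -> sle (f m) (f n))
  (gs : forall m n, sle m n -> sle (g m) (g n)).

Lemma nultrafilter_iso U : is_nultrafilter Ag C [set f m | m in ucarrier U].
Proof.
have [fU Umax] := SigmaP U; split; first exact: (@nfilter_iso f g).
move=> V fV UV; have /nfilterP[_ VN _ _] := fV.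
have VU : [set g m | m in V] = U :> set A.
  apply: Umax; first exact: (@nfilter_iso g f).
  move=> m Um; exists (f m); last by rewrite fK//; exact: ufN Um.
  by apply: UV; exists m.
apply/seteqP; split=> // m Vm; exists (g m); last by rewrite gK//; have [] := VN _ Vm.
by rewrite -VU; exists m.
Qed.

End OrderIsomorphism.

Lemma inverseS_carrier U : ucarrier (inverseS U) = [set m† | m in ucarrier U].
Proof.
apply: insubdS; apply: (@nultrafilter_iso (dagger C) (dagger C)) => //.
- exact: daggerI I0.
- exact: daggerI I0.
- exact: daggerK.
- exact: daggerK.
- exact: sle_dagger.
- exact: sle_dagger.
Qed.

Lemma scaleS_carrier r s U : r * s = 1 ->
  ucarrier (scaleS r U) = [set r *: m | m in ucarrier U].
Proof.
move=> rs; have sr : s * r = 1 by rewrite mulrC.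
apply: insubdS; apply: (@nultrafilter_iso ( *:%R r) ( *:%R s)).
- by rewrite scaler0.
- by rewrite scaler0.
- by move=> m _; rewrite scalerA sr scale1r.
- by move=> m _; rewrite scalerA rs scale1r.
- by move=> m n; exact: sleZ rs.
- by move=> m n; exact: sleZ sr.
Qed.

Lemma scaleSE r s U n : r * s = 1 -> scaleS r U ∋ n <-> U ∋ s *: n.
Proof.
move=> rs; have sr : s * r = 1 by rewrite mulrC.
rewrite (scaleS_carrier _ rs); split=> [[m Um <-]|Un].
  by rewrite scalerA sr scale1r.
by exists (s *: n) => //; rewrite scalerA rs scale1r.
Qed.

Lemma value_scale a U r s : r * s = 1 -> value a (scaleS r U) = s * value a U.
Proof.
move=> rs; have sr : s * r = 1 by rewrite mulrC.
have [n Un] := uf_ex U; have [p [Up _ Ep]] := value_ex a Un.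
have Np := ufN Up; apply: (@value_eq _ _ (r *: p)).
  by rewrite (scaleS_carrier _ rs); exists p.
rewrite (daggerZ Np rs) !(amulZl, amulZr) EZ Ep !scalerA.
by congr (_ *: _); rewrite -!mulrA ?rs ?sr mulr1.
Qed.

Lemma simeqP U V :
  reflect (exists r s, r * s = 1 /\ V = scaleS r U) (simeq U V).
Proof.
apply: (iffP (asboolP _)) => [[r [s [rs UV]]]|[r [s [rs ->]]]].
  have sr : s * r = 1 by rewrite mulrC.
  exists s, r; split=> //; apply: uf_eq => n Vn; apply/(scaleSE _ _ sr).
  by rewrite UV; exists n.
have sr : s * r = 1 by rewrite mulrC.
exists s, r; split=> //; rewrite (scaleS_carrier _ rs).
apply/seteqP; split=> m.
  by move=> Um; exists (r *: m); [exists m|rewrite scalerA sr scale1r].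
by move=> [_ [n Un <-] <-]; rewrite scalerA sr scale1r.
Qed.

Local Notation q := (@qG R Gamma A Ag C).

Lemma qG_eqP U V : q U = q V <-> exists r s, r * s = 1 /\ V = scaleS r U.
Proof.
split=> [/eqmodP/simeqP//|h]; apply/eqmodP; exact/simeqP.
Qed.

Lemma qG_scale U r s : r * s = 1 -> q (scaleS r U) = q U.
Proof. by move=> rs; apply/esym/qG_eqP; exists r, s. Qed.

Lemma qG_repr (alpha : Gstar Ag C) : q (repr alpha) = alpha.
Proof. exact: reprK. Qed.

(** Equivariance makes the locus where [value a] does not vanish a union of
[simeq]-classes. *)
Lemma suppG_valueP a U : suppG (value a) (q U) <-> value a U <> 0.
Proof.
split=> [[V VS /qG_eqP[r [s [rs ->]]]]|aU]; last by exists U => //; apply/eqP.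
rewrite (value_scale _ _ rs) => /(congr1 ( *%R r)).
by rewrite mulrA rs mul1r mulr0; apply/eqP.
Qed.

Lemma suppG_N n : N n -> suppG (value n) `<=` q @` Vs n.
Proof.
move=> Nn _ [U /eqP nU <-]; have [//|[r [s [rs Un _]]]] := value_N_cases U Nn.
have sr : s * r = 1 by rewrite mulrC.
exists (scaleS r U); last exact: qG_scale rs.
exact/(scaleSE _ _ rs).
Qed.

(** The union of the classes that meet [Vset n] is the union of the basic sets of
the unit multiples of [n]. *)
Lemma open_qG (X : set Sig) : open X -> open (q @` X).
Proof.
move=> /open_SigmaP oX; apply/open_SigmaP => V [U XU /qG_eqP[r [s [rs ->]]]].
have [n Un nX] := oX _ XU.
exists (r *: n); first by rewrite (scaleS_carrier _ rs); exists n.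
move=> W Wn; have sr : s * r = 1 by rewrite mulrC.
exists (scaleS s W); last exact: qG_scale sr.
exact/nX/(scaleSE _ _ sr).
Qed.

Lemma qG_continuous : continuous q.
Proof. exact: pi_continuous. Qed.

(** The support lies in the union of the finitely many compact sets belonging to
the normalisers in an expression of [a], and it is closed. *)
Lemma compact_suppG_value a : compact (suppG (value a)).
Proof.
have [X cX aX] : exists2 X, compact X & suppG (value a) `<=` X.
  elim/Nstar_span_ind: a => [|r n a Nn [X cX aX]].
    exists set0; first exact: compact0.
    by move=> alpha [U /eqP + _]; rewrite value0.
  exists (q @` Vs n `|` X).
    apply: compactU => //; apply: continuous_compact; last exact: compact_Vset.
    by apply: continuous_subspaceT; exact: qG_continuous.
  move=> _ [U /eqP + <-]; rewrite value_linear => vU.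
  have [nU|nU] := pselect (value n U = 0).
    right; apply: aX; apply/suppG_valueP => aU; apply: vU.
    by rewrite nU aU mulr0 addr0.
  by left; apply: suppG_N => //; apply/suppG_valueP.
apply: (subclosed_compact _ cX aX).
rewrite (_ : suppG _ = ~` (q @` [set U | value a U = 0])).
  apply/open_closedC/open_qG; apply: (locally_constant_open [set 0]).
  exact: locally_constant_value.
apply/seteqP; split=> alpha.
  move=> [U /eqP aU <-] [V /= aV /qG_eqP[r [s [rs UE]]]]; apply: aU.
  by rewrite UE (value_scale _ _ rs) aV mulr0.
rewrite -(qG_repr alpha) => h; apply/suppG_valueP => v0; apply: h.
by exists (repr alpha).
Qed.

Lemma value_twisted a : twisted_steinberg Ag C (value a).
Proof.
split; [exact: locally_constant_value|by move=> r s U /value_scale->|].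
exact: compact_suppG_value.
Qed.

(** * Twisted functions are values of elements *)

Lemma R_nontrivial U : 1 <> 0 :> R.
Proof.
move=> R0; have [n Un] := uf_ex U; apply: (uf_neq0 Un).
by rewrite -[n]scale1r R0 scale0r.
Qed.

Lemma unit_neq0 U r s : r * s = 1 -> r <> 0.
Proof. by move=> rs r0; apply: (R_nontrivial U); rewrite -rs r0 mul0r. Qed.

(** The part of [n] away from the locus where [m] has nonzero values. *)
Definition ndiff n m := let k := E (n† ** m) in n - n ** (k† ** k).

Lemma E_dagger_N n m : N n -> N m -> N (E (n† ** m)).
Proof.
move=> Nn Nm; have [e Ie ->] := E_N (NM (N_dagger Nn) Nm).
by apply: NIM => //; apply: NM => //; exact: N_dagger.
Qed.

Lemma sle_ndiff n m : N n -> N m -> sle (ndiff n m) n.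
Proof. by move=> Nn Nm; apply: sle_sub => //; apply/I_source/E_dagger_N. Qed.

Lemma I_ndiff e f : I e -> I f -> I (ndiff e f).
Proof.
by move=> Ie If; apply: IB => //; apply/I_source/E_dagger_N; exact: I_N.
Qed.

(** Near an ultrafilter containing [n], the value of [m] is that of
[k = E (n† ** m)]. As [k] is a normaliser in [C], it is invertible on its source
[h] and zero off it, so the value of [m] is zero exactly when the ultrafilter
contains [n - n ** h] rather than [n ** h]. *)
Lemma uf_ndiff U n m : U ∋ n -> N m ->
  if value m U == 0 then U ∋ ndiff n m else value (ndiff n m) U = 0.
Proof.
move=> Un Nm; have Nn := ufN Un; rewrite /ndiff; set k := E (n† ** m).
have Ck : C k by exact: EC.
have Nk : N k by exact: E_dagger_N.
have [h hE] : exists h, h = k† ** k by exists (k† ** k).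
have Ih : I h by rewrite hE; exact: I_source.
have kh : k ** h = k by rewrite hE amulA mulNdN.
have dn e : I e -> (n ** e)† = e ** n†.
  by move=> Ie; rewrite daggerM ?(daggerI Ie)//; exact: I_N.
rewrite -/k -hE; have [Unh|Und] := uf_mulI Un Ih.
  have [p [Up pnh Ep]] := value_ex m Unh.
  case: eqP => [v0|_]; last first.
    apply: (value_eq Unh); rewrite dn// scale0r -[RHS](E_id C0); congr E.
    rewrite amulBr !amulA -(amulA h n† n) (CC (IC Ih) (IC (I_source Nn))).
    by rewrite -[X in _ - X]amulA Iidem// subrr.
  exfalso; apply: (uf_neq0 Up); have [_ [g Ig pg]] := pnh.
  move: Ep; rewrite v0 scale0r pg -amulA dn; last exact: IM.
  rewrite -amulA E_mulC -/k; last exact/IC/IM.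
  rewrite (CC (IC Ih) (IC Ig)) -amulA (CC (IC Ih) Ck) kh => gk.
  by rewrite hE (CC (C_dagger Ck Nk) Ck) (amulA g) gk amul0r amulr0.
case: eqP => // v0; case: v0; have Is := I_source Nn.
apply: (value_eq Und); rewrite sub_mulI// dn ?scale0r; last exact: IB.
rewrite -amulA E_mulC; last exact/IC/IB.
by rewrite -/k amulBl -(amulA _ h) (CC (IC Ih) Ck) kh subrr.
Qed.

Lemma value_sle U m n : sle m n -> value n U = 0 -> value m U = 0.
Proof.
move=> mn n0; have [//|[r [s [rs Us _]]]] := value_N_cases U (sleNl mn).
have sr : s * r = 1 by rewrite mulrC.
case: (unit_neq0 U rs); rewrite -n0; apply/esym/(value_N_unit rs (sleNr mn)).
by apply: uf_up Us _; exact: sleZ sr mn.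
Qed.

Lemma value_ndiff U n m : N n -> N m ->
  value (ndiff n m) U = if value m U == 0 then value n U else 0.
Proof.
move=> Nn Nm; have dn := sle_ndiff Nn Nm.
have [n0|[r [s [rs Us vn]]]] := value_N_cases U Nn.
  by rewrite n0 (value_sle dn n0) if_same.
have sr : s * r = 1 by rewrite mulrC.
have Vn : scaleS r U ∋ n by exact/(scaleSE _ _ rs).
have := uf_ndiff Vn Nm; rewrite !(value_scale _ _ rs).
have can t : s * t = 0 -> t = 0.
  by move=> /(congr1 ( *%R r)); rewrite mulrA rs mul1r mulr0.
case: (value m U =P 0) => [->|m0]; last first.
  by rewrite ifF; [exact: can|apply/eqP => /can].
rewrite mulr0 eqxx => /value_N; rewrite (value_scale _ _ rs).
by move=> /(congr1 ( *%R r)); rewrite mulrA rs mul1r mulr1 vn.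
Qed.

(** A function agreeing with a multiple of [H n] on the support of each of
finitely many [H n] that cover its support is a value of [H]: subtract the
multiples one at a time, cutting the remaining [n] down to the complement of
the support that has been dealt with. *)
Lemma span_cover (X : set A) (H : A -> Sig -> R) (d : A -> A -> A)
    (s : seq (R * A)) (f : Sig -> R) :
    (forall r a b U, H (r *: a + b) U = r * H a U + H b U) ->
    (forall U, H 0 U = 0) ->
    (forall n m, X n -> X m -> X (d n m)) ->
    (forall n m U, X n -> X m -> H (d n m) U = if H m U == 0 then H n U else 0) ->
    (forall rn, rn \in s -> X rn.2) ->
    (forall rn U, rn \in s -> H rn.2 U <> 0 -> f U = rn.1 * H rn.2 U) ->
    (forall U, f U <> 0 -> exists2 rn, rn \in s & H rn.2 U <> 0) ->
  exists2 a, Rspan X a & H a = f.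
Proof.
move=> Hlin H0 dX Hd.
elim: {s}(size s) {-2}s (erefl (size s)) f => [|l ih] [|[r n] s]//=.
  move=> _ f _ _ fs; exists 0; first exact: Rspan0.
  apply/funext => U; rewrite H0; have [->//|/fs[rn]] := pselect (f U = 0).
  by rewrite in_nil.
move=> [sl] f sX fE fs; have Xn : X n by apply: (sX (r, n)); exact: mem_head.
have sX' rm : rm \in s -> X rm.2 by move=> ms; apply: sX; rewrite inE ms orbT.
have [||||a Xa aE] := ih [seq (rm.1, d rm.2 n) | rm <- s] _
    (fun U => f U - r * H n U).
- by rewrite size_map.
- by move=> _ /mapP[[t m] ms ->] /=; apply: dX => //; exact: (sX' (t, m)).
- move=> _ U /mapP[[t m] ms ->] /=; have Xm := sX' _ ms; rewrite (Hd _ _ _ Xm Xn).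
  case: eqP => // n0 m0; rewrite n0 mulr0 subr0.
  by apply: (fE (t, m)) => //; rewrite inE ms orbT.
- move=> U; have [n0|n0] := pselect (H n U = 0); last first.
    by rewrite (fE (r, n)) ?mem_head//= subrr.
  rewrite n0 mulr0 subr0 => /fs[[t m]]; rewrite inE => /orP[/eqP[_ ->] //|ms m0].
  exists (t, d m n); first by apply/mapP; exists (t, m).
  by rewrite /= (Hd _ _ _ (sX' _ ms) Xn) n0 eqxx.
exists (r *: n + a); first exact: RspanD.
by apply/funext => U; rewrite Hlin aE addrC subrK.
Qed.

(** By compactness finitely many of these basic sets suffice. Equivariance extends
the constant on [Vset n] to a multiple of [value n] on its whole support. *)
Lemma twisted_span (X : set A) (f : Sig -> R) : X `<=` N ->
    (forall n m, X n -> X m -> X (ndiff n m)) ->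
    twisted_steinberg Ag C f ->
    (forall U, f U <> 0 -> exists V n, [/\ q V = q U, V ∋ n, X n &
       forall W, W ∋ n -> f W = f V]) ->
  exists2 a, Rspan X a & value a = f.
Proof.
move=> XN dX [lf fZ cf] fX; pose cst n r := forall W, W ∋ n -> f W = r.
have [n _|_ [U /eqP fU <-]|D DX fD] := @compact_finite_cover _ _ _
    [set n : A | X n /\ exists r, cst n r] (fun n => q @` Vs n) cf.
- exact/open_qG/open_Vset.
- have [V [n [VU Vn Xn fV]]] := fX _ fU.
  by exists n; [split=> //; exists (f V)|exists V].
pose cv n : R := xget 0 [set r | cst n r].
have DX' n : n \in D -> X n /\ cst n (cv n).
  move=> /DX[Xn [r nr]]; split=> //.
  by rewrite /cv; case: xgetP => // /(_ r).
apply: (@span_cover X value ndiff [seq (cv n, n) | n <- D]) => //.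
- exact: value_linear.
- exact: value0.
- by move=> n m U /XN Nn /XN; exact: value_ndiff.
- by move=> _ /mapP[n /DX'[Xn _] ->].
- move=> _ U /mapP[n /DX'[/XN Nn cn] ->] /= n0.
  have [//|[r [s [rs Us ->]]]] := value_N_cases U Nn.
  have <- : f (scaleS r U) = cv n by apply: cn; exact/(scaleSE _ _ rs).
  by rewrite (fZ _ _ _ rs) mulrC mulrA rs mul1r.
- move=> U fU; have [|n nD [V Vn /qG_eqP[r [s [rs ->]]]]] := fD (q U).
    by exists U => //; exact/eqP.
  exists (cv n, n); first by apply/mapP; exists n.
  rewrite (value_scale _ _ rs) /= value_N// mulr1.
  by apply: (unit_neq0 U (s := r)); rewrite mulrC.
Qed.

Lemma value_surjective (f : Sig -> R) : twisted_steinberg Ag C f -> exists a, value a = f.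
Proof.
move=> tf; have [|||a _ <-] := @twisted_span N f _ _ tf; last by exists a.
- by move=> n.
- by move=> n m Nn Nm; exact: sleNl (sle_ndiff Nn Nm).
move=> U fU; have [lf _ _] := tf; have /nbhs_SigmaP[n Un nf] := lf U.
by exists U, n; split=> //; exact: ufN Un.
Qed.

Lemma Rspan_IC a : Rspan I a -> C a.
Proof. by have [[_ [_ CE _ _]] _] := pairA; rewrite -CE. Qed.

Lemma value_C_surjective (f : Sig -> R) : twisted_steinberg0 Ag C f ->
  exists2 c, C c & value c = f.
Proof.
move=> [tf f0]; have [|||c Cc <-] := @twisted_span I f _ _ tf; last first.
- by exists c => //; exact: Rspan_IC.
- move=> U fU; have [|V V0 VU] := f0 (q U); first by exists U => //; exact/eqP.
  have [e Ie Ve] := (Sigma0P V).1 V0; have [lf _ _] := tf.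
  have /nbhs_SigmaP[n Vn nf] := lf V; have [p [Vp [_ [g Ig pe]] pn]] := uf_dir Ve Vn.
  exists V, p; split=> //; first by rewrite pe; exact: IM.
  by move=> W Wp; apply: nf; exact: uf_up Wp pn.
- exact: I_ndiff.
- by move=> e; exact: I_N.
Qed.

Lemma value_C_twisted0 c : C c -> twisted_steinberg0 Ag C (value c).
Proof.
move=> Cc; split; first exact: value_twisted.
move: c Cc; apply: C_span_ind => [|r e c Ie ih] _ [U /eqP vU <-].
  by case: vU; rewrite value0.
have [e0|] := value_N_cases U (I_N Ie).
  apply: ih; apply/suppG_valueP => c0; apply: vU.
  by rewrite value_linear e0 c0 mulr0 addr0.
move=> [t [s [ts Us _]]]; exists (scaleS t U); last exact: qG_scale ts.
by apply/Sigma0P; exists e => //; exact/(scaleSE _ _ ts).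
Qed.

(** * The isomorphism [phi] *)

Lemma value_C_eq U c e r : C c -> I e -> U ∋ e -> c ** e = r *: e -> value c U = r.
Proof.
move=> Cc Ie Ue ce; apply: (value_eq Ue); rewrite (daggerI Ie) Iidem//.
by rewrite (E_id (CM (IC Ie) Cc)) (CC (IC Ie) Cc).
Qed.

Lemma value_C_ex U c : C c -> Sigma0 Ag C U ->
  exists e, [/\ I e, U ∋ e & c ** e = value c U *: e].
Proof.
move=> Cc /Sigma0P[e Ie Ue]; have [p [Up [_ [f If pe]] Ep]] := value_ex c Ue.
have Ip : I p by rewrite pe; exact: IM.
exists p; split=> //; move: Ep.
by rewrite (daggerI Ip) Iidem// (E_id (CM (IC Ip) Cc)) (CC (IC Ip) Cc).
Qed.

(** At unit ultrafilters, [phi] is the value map. *)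
Definition phi0 c U : R := if `[< Sigma0 Ag C U >] then value c U else 0.

Lemma phi0E c U : Sigma0 Ag C U -> phi0 c U = value c U.
Proof. by rewrite /phi0 => /asboolT->. Qed.

Lemma phi0_out c U : ~ Sigma0 Ag C U -> phi0 c U = 0.
Proof. by rewrite /phi0 => /asboolF->. Qed.

Lemma phi0_linear r a b U : phi0 (r *: a + b) U = r * phi0 a U + phi0 b U.
Proof. by rewrite /phi0; case: ifP; rewrite ?value_linear// mulr0 addr0. Qed.

Lemma phi0_zero U : phi0 0 U = 0.
Proof. by rewrite /phi0 value0 if_same. Qed.

Lemma phi0_mul c d U : C c -> C d -> phi0 (c ** d) U = phi0 c U * phi0 d U.
Proof.
move=> Cc Cd; have [U0|U0] := pselect (Sigma0 Ag C U); last first.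
  by rewrite !phi0_out// mulr0.
rewrite !phi0E//; have [e [Ie Ue ce]] := value_C_ex Cc U0.
have [f [If Uf df]] := value_C_ex Cd U0.
have Uef : U ∋ e ** f.
  have [p [Up [_ [g Ig pe]] [_ [h Ih pf]]]] := uf_dir Ue Uf.
  apply: uf_up Up _; split; first exact/I_N/IM.
  exists p; first by rewrite pe; exact: IM.
  have Ip : I p by rewrite pe; exact: IM.
  have fp : f ** p = p by rewrite pf amulA Iidem.
  by rewrite -amulA fp pe amulA Iidem.
apply: (value_C_eq (CM Cc Cd) (IM Ie If) Uef).
rewrite -!amulA (CC (IC Ie) (IC If)) (amulA d) df amulZl amulZr.
by rewrite (CC (IC If) (IC Ie)) amulA ce amulZl scalerA mulrC.
Qed.

Lemma phi0_I e U : I e -> phi0 e U = (`[< Vs e U >])%:R.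
Proof.
move=> Ie; case: asboolP => Ue.
  by rewrite phi0E ?value_N//; apply/Sigma0P; exists e.
have [U0|U0] := pselect (Sigma0 Ag C U); last exact: phi0_out.
rewrite phi0E//; have [//|[r [s [rs Us _]]]] := value_N_cases U (I_N Ie).
case: Ue; have /Sigma0P[f If Uf] := U0.
have [p [Up [_ [g Ig pf]] [_ [h Ih ph]]]] := uf_dir Uf Us.
have Ip : I p by rewrite pf; exact: IM.
apply: uf_up Up _; split; first exact: I_N.
by exists p => //; rewrite ph amulZl amulZr amulA Iidem.
Qed.

Lemma phi0_steinberg c : C c -> steinberg_Sigma0 Ag C (phi0 c).
Proof.
move=> Cc; split=> [U|U U0|]; first exact: phi0_out.
  apply: filterS (locally_constant_value c U) => V vV V0.
  by rewrite !phi0E.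
have [X [cX XS cE]] : exists X, [/\ compact X, X `<=` Sigma0 Ag C &
    supp (phi0 c) `<=` X].
  move: c Cc; apply: C_span_ind => [|r e c Ie [X [cX XS cE]]].
    by exists set0; split=> // [|U /eqP]; [exact: compact0|rewrite phi0_zero].
  exists (Vs e `|` X); split; first by apply: compactU => //; exact/compact_Vset/I_N.
    by rewrite subUset; split=> // U Ue; apply/Sigma0P; exists e.
  move=> U /eqP; rewrite phi0_linear phi0_I//; case: asboolP; first by left.
  by rewrite mulr0 add0r => _ cU; right; apply: cE; exact/eqP.
rewrite (_ : supp (phi0 c) = X `&` supp (value c)).
  by apply: compact_closedI => //; apply/closed_supp/locally_constant_value.
apply/seteqP; split=> U; rewrite /supp /=.
  by move=> cU; have XU := cE _ cU; split=> //; rewrite -phi0E//; exact: XS.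
by move=> [XU]; rewrite phi0E//; exact: XS.
Qed.

Lemma phi0_injective c : C c -> (forall U, phi0 c U = 0) -> c = 0.
Proof.
move=> Cc c0; apply: contrapT => cn.
have hc := subC Cc; have [||e Ie he] := @local_units1 [set c].
- exact: finite_set1.
- by move=> _ ->.
have [ec _] := he c erefl; have [|U Ue] := @value_separates c e (I_N Ie).
  by rewrite (daggerI Ie) ec (E_id Cc).
by rewrite -phi0E//; apply/Sigma0P; exists e.
Qed.

Lemma phi0_surjective (f : Sig -> R) : steinberg_Sigma0 Ag C f ->
  exists2 c, C c & phi0 c = f.
Proof.
move=> [f0 lf cf]; pose cst n r := forall W, W ∋ n -> f W = r.
have fS U : f U <> 0 -> Sigma0 Ag C U.
  by move=> fU; apply: contrapT => /f0.
have [n _|U /eqP fU|D DX fD] := @compact_finite_cover _ _ _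
    [set n : A | I n /\ exists r, cst n r] Vs cf.
- exact: open_Vset.
- have U0 := fS _ fU; have [e Ie Ue] := (Sigma0P U).1 U0.
  have /nbhs_SigmaP[n Un nf] := lf _ U0.
  have [p [Up [_ [g Ig pe]] pn]] := uf_dir Ue Un.
  have Ip : I p by rewrite pe; exact: IM.
  exists p => //; split=> //; exists (f U) => W Wp.
  by apply: nf; [exact: uf_up Wp pn|apply/Sigma0P; exists p].
pose cv n : R := xget 0 [set r | cst n r].
have DX' n : n \in D -> I n /\ cst n (cv n).
  move=> /DX[Xn [r nr]]; split=> //.
  by rewrite /cv; case: xgetP => // /(_ r).
have [|||||||c Cc <-] := @span_cover I phi0 ndiff
    [seq (cv n, n) | n <- D] f; last by exists c => //; exact: Rspan_IC.
- exact: phi0_linear.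
- exact: phi0_zero.
- exact: I_ndiff.
- move=> e g U Ie Ig; have [U0|U0] := pselect (Sigma0 Ag C U).
    by rewrite !phi0E//; apply: value_ndiff; exact: I_N.
  by rewrite !phi0_out// if_same.
- by move=> _ /mapP[n /DX'[Xn _] ->].
- move=> _ U /mapP[n /DX'[In cn] ->] /=; rewrite phi0_I//.
  by case: asboolP => // Un _; rewrite mulr1; exact: cn.
- move=> U fU; have [|n nD Un] := fD U; first exact/eqP.
  exists (cv n, n); first by apply/mapP; exists n.
  have [In _] := DX' _ nD.
  by rewrite phi0_I//= asboolT//; exact: R_nontrivial.
Qed.

Lemma is_phi0 : is_phi Ag C phi0.
Proof.
split=> [r c d Cc Cd|c d Cc Cd||e Ie]; try apply/funext => U.
- exact: phi0_linear.
- exact: phi0_mul.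
- split; first by move=> c; exact: phi0_steinberg.
    move=> c d; rewrite !inE => Cc Cd cd; apply/eqP; rewrite -subr_eq0; apply/eqP.
    apply: phi0_injective => [|U]; first exact: CD (CN Cd).
    rewrite -scaleN1r addrC phi0_linear cd mulN1r addNr//.
  by move=> f /phi0_surjective[c Cc <-]; exists c.
- exact: phi0_I.
Qed.

Lemma phi_value c U : C c -> Sigma0 Ag C U -> phi Ag C c U = value c U.
Proof.
have [lin mul _ one] : is_phi Ag C (phi Ag C).
  by rewrite /phi; case: xgetP => [h _ //|/(_ _ is_phi0)].
move=> Cc U0; have [e [Ie Ue ce]] := value_C_ex Cc U0.
have := congr1 (fun h => h U) (mul _ _ Cc (IC Ie)); rewrite /= ce.
rewrite -[value c U *: e]addr0 (lin _ _ _ (IC Ie) C0) (one _ Ie) (one _ I0).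
rewrite asboolT// asboolF ?mulr1 ?addr0; first by move=> ->.
by move=> /uf_neq0.
Qed.

(** * Products of ultrafilters *)

(** Translation by [n†] is an inverse of the translation by [n], up to restriction
to the range [n ** n†]; this transfers maximality. *)
Lemma uf_translate U n : N n -> (forall m, U ∋ m -> n ** m <> 0) ->
  is_nultrafilter Ag C [set x | exists2 m, U ∋ m & sle (n ** m) x].
Proof.
move=> Nn nU.
have -> : [set x | exists2 m, U ∋ m & sle (n ** m) x] =
    [set x | exists2 y, [set n ** m | m in ucarrier U] y & sle y x].
  apply/seteqP; split=> x; first by move=> [m Um mx]; exists (n ** m) => //; exists m.
  by move=> [_ [m Um <-] mx]; exists m.
have fN : is_nfilter Ag C
    [set x | exists2 y, [set n ** m | m in ucarrier U] y & sle y x].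
  apply: nfilter_base; first by have [m Um] := uf_ex U; exists (n ** m), m.
    by move=> _ [m Um <-]; split; [apply: NM => //; exact: ufN Um|exact: nU].
  move=> _ _ [m Um <-] [m' Um' <-]; have [p [Up pm pm']] := uf_dir Um Um'.
  by exists (n ** p); split; [exists p|exact: sle_mull..].
split=> // V fV nUV; apply/seteqP; split=> // w Vw.
have /nfilterP[_ VN Vup Vdir] := fV.
have nV m : U ∋ m -> V (n ** m).
  move=> Um; apply: nUV; exists (n ** m); first by exists m.
  by apply/sle_refl/NM => //; exact: ufN Um.
(* translating [V] back by [n†] gives a filter base finer than [U] *)
have Un : U ∋ n† ** w.
  apply: (@uf_base U [set n† ** v | v in V]); last by exists w.
  - move=> _ [v Vv <-]; have [Nv _] := VN _ Vv.
    split; first by apply: NM => //; exact: N_dagger.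
    have [m Um] := uf_ex U; have [p [Vp pv [_ [e Ie pe]]]] := Vdir _ _ Vv (nV _ Um).
    move=> nv0; have [_ p0] := VN _ Vp; apply: p0.
    have [_ [f If pf]] := pv.
    have <- : n ** (n† ** p) = p by rewrite pe !amulA mulNdN.
    by rewrite pf (amulA n†) nv0 amul0r amulr0.
  - move=> _ _ [v Vv <-] [v' Vv' <-]; have [p [Vp pv pv']] := Vdir _ _ Vv Vv'.
    by exists (n† ** p); split; [exists p|apply: sle_mull => //; exact: N_dagger..].
  - move=> u Uu; exists (n† ** (n ** u)); first by exists (n ** u) => //; exact: nV.
    by rewrite amulA; apply: sle_Imul; [exact: ufN Uu|exact: I_source].
exists (n ** (n† ** w)); first by exists (n† ** w).
have [Nw _] := VN _ Vw.
by rewrite amulA; apply: sle_Imul => //; exact: I_range.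
Qed.

Definition composable U V := forall m n, U ∋ m -> V ∋ n -> m ** n <> 0.

(** Replacing [m'] by a common lower bound with [m] moves a restriction onto the
right factor, and composability keeps that factor in [V]. *)
Lemma composable_left U V m x : composable U V -> U ∋ m ->
  (exists n, V ∋ n /\ sle (m ** n) x) <->
  (exists m' n, [/\ U ∋ m', V ∋ n & sle (m' ** n) x]).
Proof.
move=> UV Um; split=> [[n [Vn nx]]|[m' [n [Um' Vn mnx]]]]; first by exists m, n.
have [p [Up pm pm']] := uf_dir Um Um'; have [_ [e Ie pe]] := pm.
exists (e ** n); split.
  have [//|Vd] := uf_Imul Vn Ie; exfalso; apply: (UV _ _ Up Vd).
  by rewrite pe amulBr !amulA -(amulA m e e) Iidem// subrr.
rewrite amulA -pe; apply: sle_trans mnx; apply: sle_mulr pm'; exact: ufN Vn.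
Qed.

Lemma mulSP U V x : composable U V ->
  mulS U V ∋ x <-> exists m n, [/\ U ∋ m, V ∋ n & sle (m ** n) x].
Proof.
move=> UV; have [m Um] := uf_ex U; have Nm := ufN Um.
have XE : upset Ag C [set m ** n | m in ucarrier U & n in ucarrier V] =
    [set x | exists2 n, V ∋ n & sle (m ** n) x].
  apply/seteqP; split=> y.
    move=> [Ny [_ [m' Um' [n Vn <-]] mny]].
    have [|n' [Vn' n'y]] := (composable_left y UV Um).2; last by exists n'.
    exists m', n; split=> //; apply/sleP => //.
    by apply: NM; [exact: ufN Um'|exact: ufN Vn].
  move=> [n Vn ny]; split; first exact: sleNr ny.
  exists (m ** n); first by exists m => //; exists n.
  apply/sleP => //; last exact: sleNr ny.
  exact: sleNl ny.
rewrite -(composable_left x UV Um) /mulS insubdS XE; last first.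
  by apply: uf_translate => // n Vn; exact: UV.
by split=> [[n Vn nx]|[n [Vn nx]]]; exists n.
Qed.

Lemma inverseSP U x : inverseS U ∋ x <-> N x /\ U ∋ x†.
Proof.
rewrite inverseS_carrier; split=> [[m Um <-]|[Nx Ux]].
  by have Nm := ufN Um; rewrite daggerK//; split=> //; exact: N_dagger.
by exists x† => //; exact: daggerK.
Qed.

Lemma inverseS_dagger U m : U ∋ m -> inverseS U ∋ m†.
Proof. by rewrite inverseS_carrier => Um; exists m. Qed.

Lemma sle_range_mono m n : sle m n -> sle (m ** m†) (n ** n†).
Proof.
move=> mn; have Nm := sleNl mn; have Nn := sleNr mn.
apply: (@sle_trans (n ** m†)); first by apply: sle_mulr => //; exact: N_dagger.
by apply: sle_mull => //; exact: sle_dagger.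
Qed.

Lemma sle_mul_dagger p m n : sle p m -> sle p n -> sle (p ** p†) (m ** n†).
Proof.
move=> pm pn; apply: (@sle_trans (m ** p†)).
  by apply: sle_mulr => //; apply/N_dagger/(sleNl pm).
by apply: sle_mull; [exact: sleNr pm|exact: sle_dagger].
Qed.

Lemma uf_mul_dagger U m n : U ∋ m -> U ∋ n -> m ** n† <> 0.
Proof.
move=> Um Un mn0; have [p [Up pm pn]] := uf_dir Um Un.
apply: (uf_neq0 Up); rewrite -(mulNdN (ufN Up)).
by have [_ [e _ ->]] := sle_mul_dagger pm pn; rewrite mn0 !amul0r.
Qed.

Lemma uf_dagger_mul U m n : U ∋ m -> U ∋ n -> m† ** n <> 0.
Proof.
move=> Um Un; have Nm := ufN Um; have Nn := ufN Un.
have := uf_mul_dagger (inverseS_dagger Um) (inverseS_dagger Un).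
by rewrite daggerK.
Qed.

Lemma rngSP U x : rngS U ∋ x <-> exists2 m, U ∋ m & sle (m ** m†) x.
Proof.
rewrite /rngS mulSP; last first.
  move=> m n Um /inverseSP[Nn Un]; rewrite -(daggerK Nn).
  exact: uf_mul_dagger Um Un.
split=> [[m [n [Um /inverseSP[Nn Un] mnx]]]|[m Um mx]].
  have [p [Up pm pn]] := uf_dir Um Un; exists p => //.
  by apply: sle_trans mnx; rewrite -(daggerK Nn); exact: sle_mul_dagger.
by exists m, m†; split=> //; exact: inverseS_dagger.
Qed.

Lemma srcSP U x : srcS U ∋ x <-> exists2 m, U ∋ m & sle (m† ** m) x.
Proof.
rewrite /srcS mulSP; last first.
  move=> m n /inverseSP[Nm Um] Un; rewrite -(daggerK Nm).
  exact: uf_dagger_mul Um Un.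
split=> [[m [n [/inverseSP[Nm Um] Un mnx]]]|[m Um mx]].
  have [p [Up pm pn]] := uf_dir Um Un; exists p => //.
  have := sle_mul_dagger (sle_dagger pm) (sle_dagger pn).
  rewrite !daggerK//; [|exact: ufN Un|exact: ufN Up].
  by move=> h; exact: sle_trans mnx.
by exists m†, m; split=> //; exact: inverseS_dagger.
Qed.

Lemma rngS_range U m : U ∋ m -> rngS U ∋ m ** m†.
Proof.
move=> Um; apply/rngSP; exists m => //.
by apply/sle_refl/I_N/I_range/(ufN Um).
Qed.

Lemma srcS_source U m : U ∋ m -> srcS U ∋ m† ** m.
Proof.
move=> Um; apply/srcSP; exists m => //.
by apply/sle_refl/I_N/I_source/(ufN Um).
Qed.

Lemma rngS_composable U V : rngS V = rngS U ->
  forall n m, V ∋ n -> U ∋ m -> n† ** m <> 0.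
Proof.
move=> rVU n m Vn Um nm0; have := rngS_range Vn; rewrite rVU => Rn.
have [p [Rp [_ [e Ie pe]] [_ [f If pf]]]] := uf_dir Rn (rngS_range Um).
have Ip : I p by rewrite pe; apply: IM => //; exact/I_range/(ufN Vn).
apply: (uf_neq0 Rp); rewrite -(Iidem Ip) {1}pe pf.
rewrite (CC (IC (I_range (ufN Vn))) (IC Ie)) -!amulA (amulA n†) nm0.
by rewrite !(amul0r, amulr0).
Qed.

Lemma range_mem U n m : N n -> (forall m, U ∋ m -> n† ** m <> 0) ->
  U ∋ m -> U ∋ n ** n† ** m.
Proof.
move=> Nn nU Um; have [//|Ud] := uf_Imul Um (I_range Nn).
by case: (nU _ Ud); rewrite amulBr !amulA muldNd// subrr.
Qed.

(** The elements of [V^-1 U] are generated by the [n† ** m] with [m] in [U], and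
[m] below [n ** n† ** m] gives the same source to [m] and to [n† ** m]. *)
Lemma value_translate U V n b : V ∋ n -> rngS V = rngS U ->
  value b (mulS (inverseS V) U) = value (n ** b) U.
Proof.
move=> Vn rVU; have Nn := ufN Vn; have nU := rngS_composable rVU.
have nUn m : U ∋ m -> n† ** m <> 0 by exact: nU Vn.
have [m0 Um0] := uf_ex U; have Um1 := range_mem Nn nUn Um0.
have [m [Um mm Em]] := value_ex (n ** b) Um1; have Nm := ufN Um.
have nm : n ** n† ** m = m.
  by have [_ [e _ ->]] := mm; rewrite !amulA mulNdN.
have Wm : mulS (inverseS V) U ∋ n† ** m.
  apply/mulSP.
    by move=> x y /inverseSP[Nx Vx] Uy; rewrite -(daggerK Nx); exact: nU.
  exists n†, m; split=> //; first exact: inverseS_dagger.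
  by apply/sle_refl/NM => //; exact: N_dagger.
apply: (value_eq Wm); rewrite daggerM ?daggerK//; last exact: N_dagger.
by rewrite -amulA Em -amulA (amulA n) nm.
Qed.

(** An arrow containing [n] is generated by the products of [n] with the
idempotents [w ** w†] in its range. *)
Lemma rngS_inj U V n : U ∋ n -> V ∋ n -> rngS U = rngS V -> U = V.
Proof.
move=> Un Vn rUV; apply: uf_eq => m Um; have [p [Up pm pn]] := uf_dir Um Un.
have := rngS_range Up; rewrite rUV => /rngSP[w Vw wp].
have [v [Vv vw vn]] := uf_dir Vw Vn.
apply: uf_up Vv _; apply: sle_trans pm; rewrite (sle_range vn) (sle_range pn).
apply: sle_mulr; first exact: ufN Un.
exact: sle_trans (sle_range_mono vw) wp.
Qed.

(** The arrow is the inverse of the translate of [rngS U] by [n†]. *)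
Lemma rngS_lift U n : N n -> (forall m, U ∋ m -> n† ** m <> 0) ->
  exists2 V, V ∋ n & rngS V = rngS U.
Proof.
move=> Nn nU; have Nd := N_dagger Nn.
have nR x : rngS U ∋ x -> n† ** x <> 0.
  move=> /rngSP[m Um mx] nx; apply: (nU _ Um); rewrite -(mulNdN (ufN Um)).
  by have [_ [e _ ->]] := mx; rewrite !amulA nx !amul0r.
have [W WE _] := Sigma_ex (uf_translate Nd nR).
have WP x : W ∋ x <-> exists2 m, rngS U ∋ m & sle (n† ** m) x by rewrite WE.
have [m Um] := uf_ex U.
exists (inverseS W); first apply/inverseSP.
  split=> //; apply/WP; exists (m ** m†); first exact: rngS_range.
  by apply: sle_mulI => //; exact/I_range/(ufN Um).
apply: uf_eq => x /rngSP[v /inverseSP[Nv /WP[y /rngSP[k Uk ky] yv] vx]].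
have Uk' := range_mem Nn nU Uk; set k' := n ** n† ** k in Uk'.
have Nk' := ufN Uk'; have nk' : n ** n† ** k' = k'.
  by rewrite /k' !amulA mulNdN.
have k'k : sle k' k by apply: sle_Imul; [exact: ufN Uk|exact: I_range].
apply/rngSP; exists k' => //; apply: sle_trans vx.
have Ik := I_range Nk'; clearbody k'.
have kv : sle (k' ** k'† ** n) v.
  have := sle_dagger yv; rewrite daggerK//; apply: sle_trans.
  have : sle (n† ** (k' ** k'†)) (n† ** y).
    by apply: sle_mull => //; exact: sle_trans (sle_range_mono k'k) ky.
  move=> /sle_dagger; rewrite [X in sle X _]daggerM ?daggerK ?(daggerI Ik)//.
  exact: I_N.
have := sle_range_mono kv; rewrite daggerM ?(daggerI Ik)//; last exact: I_N.
suff -> : k' ** k'† ** n ** (n† ** (k' ** k'†)) = k' ** k'† by [].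
rewrite !amulA -(amulA _ n n†) -(amulA _ (n ** n†)) nk'.
by rewrite mulNdN.
Qed.

(** A unit [r] with [r *: e] idempotent for some nonzero idempotent [e] is [1] by
condition (WT), so no two unit ultrafilters are proper multiples of each other. *)
Lemma Sigma0_qG_inj U V : Sigma0 Ag C U -> Sigma0 Ag C V -> q U = q V -> U = V.
Proof.
move=> /Sigma0P[e Ie Ue] /Sigma0P[f If Vf] /qG_eqP[r [s [rs VE]]].
have Ve : V ∋ r *: e by rewrite VE (scaleS_carrier _ rs); exists e.
have [p [Vp [_ [g Ig pr]] [_ [h Ih pf]]]] := uf_dir Ve Vf.
have Ip : I p by rewrite pf; exact: IM.
have r1 : r = 1.
  have ep : e ** p = p by rewrite pr amulA amulZr Iidem.
  have gp : g ** p = p.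
    by rewrite pr amulA (CC (IC Ig) (CZ r (IC Ie))) -amulA Iidem.
  have rp : p = r *: p by rewrite -{1}(Iidem Ip) {1}pr -amulA gp amulZl ep.
  have : (r - 1) *: p = 0 by rewrite scalerBl scale1r -rp subrr.
  by move=> /(WT_N (ufN Vp) (uf_neq0 Vp)) /eqP; rewrite subr_eq0 => /eqP.
rewrite VE r1; apply: uf_eq => n Un.
by apply/(@scaleSE _ 1); rewrite ?mulr1 ?scale1r.
Qed.

Lemma Sigma0_rngS U : Sigma0 Ag C (rngS U).
Proof.
have [m Um] := uf_ex U; apply/Sigma0P; exists (m ** m†).
  exact/I_range/(ufN Um).
exact: rngS_range.
Qed.

Lemma Sigma0_srcS U : Sigma0 Ag C (srcS U).
Proof.
have [m Um] := uf_ex U; apply/Sigma0P; exists (m† ** m).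
  exact/I_source/(ufN Um).
exact: srcS_source.
Qed.

Lemma rngS_scale U r s : r * s = 1 -> rngS (scaleS r U) = rngS U.
Proof.
move=> rs; apply: uf_eq => x /rngSP[m + mx]; rewrite (scaleS_carrier _ rs).
move=> [n Un nm]; apply/rngSP; exists n => //; apply: sle_trans mx.
rewrite -nm (daggerZ (ufN Un) rs) amulZl amulZr scalerA rs scale1r.
by apply/sle_refl/I_N/I_range/(ufN Un).
Qed.

(** * Convolution *)

(** Replacing [V] by a unit multiple scales the two factors by inverse units, so
the summand may be computed at any representative. *)
Lemma convolution_term a b U V W : q V = q W -> rngS V = rngS U ->
  value a V * value b (mulS (inverseS V) U) =
  value a W * value b (mulS (inverseS W) U).
Proof.
move=> /qG_eqP[r [s [rs WE]]] rVU; have [n Vn] := uf_ex V.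
have rWU : rngS W = rngS U by rewrite WE (rngS_scale _ rs).
have Wn : W ∋ r *: n by rewrite WE (scaleS_carrier _ rs); exists n.
rewrite (value_translate b Vn rVU) (value_translate b Wn rWU).
rewrite WE (value_scale _ _ rs) amulZl -[r *: _]addr0 value_linear value0 addr0.
by rewrite mulrACA [s * r]mulrC rs mul1r.
Qed.

Section ConvolutionAt.
Variables (b : A) (U : Sig).

Let term a (alpha : Gstar Ag C) : R :=
  value a (repr alpha) * value b (mulS (inverseS (repr alpha)) U).
Let fibre := [set alpha : Gstar Ag C | rngG alpha = q (rngS U)].

Lemma term_eq a V : rngS V = rngS U ->
  term a (q V) = value a V * value b (mulS (inverseS V) U).
Proof. by move=> rVU; apply/esym/convolution_term => //; rewrite qG_repr. Qed.

Lemma fibreP V : fibre (q V) <-> rngS V = rngS U.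
Proof.
rewrite /fibre /=; have /qG_eqP[r [s [rs VE]]] : q V = q (repr (q V)).
  by rewrite qG_repr.
rewrite /rngG VE (rngS_scale _ rs); split=> [|->//].
by apply: Sigma0_qG_inj; exact: Sigma0_rngS.
Qed.

Lemma term_supp a alpha : term a alpha <> 0 -> suppG (value a) alpha.
Proof.
move=> ta; rewrite -(qG_repr alpha); apply/suppG_valueP => a0; apply: ta.
by rewrite /term a0 mul0r.
Qed.

(** On a range fibre, [value n] has at most one arrow, and translation by that
arrow turns values of [b] into values of [n ** b]. *)
Lemma convolution_normaliser n : N n -> exists alpha,
  [/\ fibre `&` [set beta | term n beta <> 0] `<=` [set alpha]
    & \sum_(beta \in fibre) term n beta = value (n ** b) U].
Proof.
move=> Nn; have supp_n alpha : fibre alpha -> term n alpha <> 0 ->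
    exists V, [/\ V ∋ n, rngS V = rngS U & q V = alpha].
  move=> Fa /term_supp/(suppG_N Nn)[V Vn VE]; exists V; split=> //.
  by apply/fibreP; rewrite VE.
have [nU|/existsNP[m /not_implyP[Um /contrapT nm]]] :=
    pselect (forall m, U ∋ m -> n† ** m <> 0).
  have [V Vn rVU] := rngS_lift Nn nU.
  have sub : fibre `&` [set beta | term n beta <> 0] `<=` [set q V].
    move=> beta [Fb /(supp_n _ Fb)[W [Wn rWU <-]]] /=; congr q.
    by apply: (rngS_inj Wn Vn); rewrite rWU rVU.
  exists (q V); split=> //; rewrite -(@fsbig_widen _ _ _ _ [set q V]).
  - by rewrite fsbig_set1 term_eq// value_N// mul1r; exact: value_translate.
  - by move=> _ ->; exact/fibreP.
  - by move=> beta [Fb nb]; apply: contrapT => tb; apply: nb; exact: sub.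
have none beta : fibre beta -> term n beta = 0.
  move=> Fb; apply: contrapT => /(supp_n _ Fb)[V [Vn rVU _]].
  exact: (rngS_composable rVU Vn Um).
exists (q U); split; first by move=> beta [/none].
rewrite fsbig1//; apply/esym/(value_eq Um).
have -> : m† ** (n ** b) = 0.
  have -> : m† ** (n ** b) = (n† ** m)† ** b.
    rewrite daggerM ?daggerK// ?amulA//; first exact: N_dagger.
    exact: ufN Um.
  by rewrite nm (daggerI I0) amul0r.
by rewrite (E_id C0) scale0r.
Qed.

(** Both sides are linear in [a]; the finiteness of the support is carried along
because sums over infinite supports are zero by convention. *)
Lemma convolution_sum a :
  finite_set (fibre `&` [set beta | term a beta <> 0]) /\
  \sum_(beta \in fibre) term a beta = value (a ** b) U.
Proof.
elim/Nstar_span_ind: a => [|r n a Nn [fa sa]].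
  have t0 beta : term 0 beta = 0 by rewrite /term value0 mul0r.
  split; first by apply: (sub_finite_set _ (finite_set0 _)) => beta [_ /(_ (t0 _))].
  by rewrite fsbig1// amul0r value0.
have [alpha [fn sn]] := convolution_normaliser Nn.
have {}fn := sub_finite_set fn (finite_set1 alpha).
have tlin beta : term (r *: n + a) beta = r * term n beta + term a beta.
  by rewrite /term value_linear mulrDl mulrA.
set D := (fibre `&` [set beta | term n beta <> 0]) `|`
  (fibre `&` [set beta | term a beta <> 0]).
have fD : finite_set D by rewrite finite_setU.
have tD beta : fibre beta -> ~ D beta -> term n beta = 0 /\ term a beta = 0.
  by move=> Fb /not_orP[nn na]; split; apply: contrapT => t0;
    [apply: nn|apply: na].
have sum h : (forall beta, fibre beta -> ~ D beta -> h beta = 0) ->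
    \sum_(beta \in fibre) h beta = \sum_(beta \in D) h beta :> R.
  move=> h0; apply/esym/fsbig_widen; first by move=> beta [] [].
  by move=> beta [Fb /(h0 _ Fb)].
split.
  apply: sub_finite_set fD => beta [Fb tb]; apply: contrapT => /(tD _ Fb)[n0 a0].
  by apply: tb; rewrite tlin n0 a0 mulr0 addr0.
rewrite amulDl amulZl value_linear -sn -sa !sum; last 3 first.
- by move=> beta Fb /(tD _ Fb)[].
- by move=> beta Fb /(tD _ Fb)[].
- by move=> beta Fb /(tD _ Fb)[n0 a0]; rewrite tlin n0 a0 mulr0 addr0.
rewrite !fsbig_finite// mulr_sumr -big_split.
by apply: eq_bigr => beta _; exact: tlin.
Qed.

Lemma convolution_value a S : section_of (value a) S ->
  convolution S (value a) (value b) U = value (a ** b) U.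
Proof.
move=> secS; rewrite -(convolution_sum a).2 /convolution.
transitivity (\sum_(alpha \in [set alpha | suppG (value a) alpha /\ fibre alpha])
    term a alpha).
  apply: eq_fsbigr => alpha; rewrite inE => -[sa Fa]; have [_ Sa] := secS _ sa.
  by rewrite -[in RHS]Sa term_eq//; apply/fibreP; rewrite Sa.
apply: fsbig_widen => [alpha []//|alpha [Fa na]] /=.
by apply: contrapT => /term_supp sa; apply: na.
Qed.

End ConvolutionAt.

(** * The hat map *)

(** Restriction to an idempotent does not change the degree, so two elements of an
ultrafilter have the degree of a common lower bound. *)
Lemma cSigma_hom U n gamma : U ∋ n -> Ag gamma n -> cSigma U = gamma.
Proof.
move=> Un hn; rewrite /cSigma; case: xgetP => [m _ Um|/(_ n)//].
have [p [Up [Nm [e Ie pm]] [_ [f If pn]]]] := uf_dir Um Un.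
have hp : Ag gamma p by rewrite pn; have := homM hn (subC (IC If)); rewrite mulg1.
have [d hm] := Nstar_hom Nm; rewrite (deg_hom hm (uf_neq0 Um)).
have hp' : Ag d p by rewrite pm; have := homM hm (subC (IC Ie)); rewrite mulg1.
exact: hom_unique hp' hp (uf_neq0 Up).
Qed.

Lemma hat_value a : hat Ag C P a = value a.
Proof.
apply/funext => U; rewrite /hat.
rewrite -(@fsbig_widen _ _ _ _ [set cSigma U])//; last first.
  by move=> g [_ /= gU]; rewrite /hat_homogeneous ifF//; apply/eqP => /esym.
rewrite fsbig_set1 /hat_homogeneous eqxx.
set n := xget 0 _; have Un : U ∋ n.
  by rewrite /n; case: xgetP => [m _ //|no]; have [m /no] := uf_ex U.
have Nn := ufN Un; have [g hn] := Nstar_hom Nn; rewrite (cSigma_hom Un hn).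
have -> : P (n† ** comp g a) = E (n† ** a).
  by rewrite /E -(mulVg g) (component_mull _ _ (dagger_hom Nn hn)).
rewrite (phi_value (EC _) (Sigma0_srcS U)).
have [p [Up pn Ep]] := value_ex a Un; have Ip := I_source (ufN Up).
apply: (value_C_eq (EC _) Ip (srcS_source Up)).
by rewrite (CC (EC _) (IC Ip)) -(E_dagger_sle _ pn).
Qed.

Lemma value_component a gamma : Ag gamma a ->
  twisted_steinberg_component Ag C gamma (value a).
Proof.
move=> ha; split; first exact: value_twisted.
move=> alpha; rewrite -(qG_repr alpha) => /suppG_valueP va.
have [r [s [rs VE]]] := (qG_eqP _ _).1 (qG_repr (q (repr alpha))).
rewrite /preimage /= /cG qG_repr.
have [n Un] := uf_ex (repr alpha); have Nn := ufN Un; have [d hn] := Nstar_hom Nn.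
rewrite (cSigma_hom Un hn); apply: contrapT => dg; apply: va; apply: (value_eq Un).
rewrite /E (component_of_hom _ (homM (dagger_hom Nn hn) ha)) scale0r.
case: eqP => [e1|_].
  case: dg; apply: (mulgI d^-1%g); rewrite mulVg; exact: e1.
by have := E_id C0; rewrite /E component0.
Qed.

Lemma hat_isomorphism : graded_isomorphism Ag C (hat Ag C P) /\
  hat Ag C P @` C = twisted_steinberg0 Ag C.
Proof.
have -> : hat Ag C P = value by apply/funext => a; exact: hat_value.
split; last first.
  apply/seteqP; split=> f; first by move=> [c Cc <-]; exact: value_C_twisted0.
  by move=> /value_C_surjective[c Cc <-]; exists c.
split=> [r a b|a b S sS||gamma].
- by apply/funext => U; exact: value_linear.
- by apply/funext => U; rewrite convolution_value.
- split; first by move=> a _; exact: value_twisted.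
    move=> a b _ _ ab; apply/eqP; rewrite -subr_eq0; apply/eqP.
    apply: value_injective => U.
    by rewrite -scaleN1r addrC value_linear ab mulN1r addNr.
  by move=> f /value_surjective[a <-]; exists a.
- by move=> _ [a ha <-]; exact: value_component.
Qed.

End GradedQuasiCartanPair.

Theorem theorem6p4 (R : comPzRingType) (Gamma : groupType) (A : nuAlgType R)
    (Ag : Gamma -> set A) (C : set A) (P : A -> A) :
  indecomposable R ->
  graded_algebra Ag ->
  is_comm_subalgebra C ->
  C `<=` Ag 1%g ->
  graded_AQP Ag C ->
  AQP_expectation (Ag 1%g) C P ->
  graded_isomorphism Ag C (hat Ag C P) /\
  hat Ag C P @` C = twisted_steinberg0 Ag C.
Proof. by move=> _; exact: hat_isomorphism. Qed.
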